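(* Assume the van Kampen setup below, with compatible future retracts $Q_k:\vec\pi_1(X_k)\to\vec\pi_1(X_k,B_k)$ and compatible future retracts $P_k:\vec\pi_1(X_k,B_k)\to\vec\pi_1(X_k,A_k)$ ($k=0,1,2$). Then there is a unique functor $P:\vec\pi_1(X,B)\to\vec\pi_1(X,A)$ with $P\circ j_k=j'_k\circ P_k$ for $k=1,2$, and the commutative cube formed by the square $(i_1,i_2,j_1,j_2)$ of the categories $\vec\pi_1(X_k,B_k)$, $\vec\pi_1(X,B)$, the square $(i'_1,i'_2,j'_1,j'_2)$ of the categories $\vec\pi_1(X_k,A_k)$, $\vec\pi_1(X,A)$, and the functors $P_0,P_1,P_2,P$, is a pushout in the arrow category of $\mathbf{Cat}$ (i.e. $P$ is the pushout of $P_1$ and $P_2$ over $P_0$).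
   Context: A d-space is a topological space with a set of continuous paths $[0,1]\to X$ (dipaths) containing all constant paths, closed under precomposition with continuous non-decreasing maps $[0,1]\to[0,1]$ and under concatenation; subsets carry the dipaths with image in them. The fundamental category $\vec\pi_1(X)$ has objects the points of $X$ and morphisms $a\to b$ the classes of dipaths from $a$ to $b$ modulo the equivalence relation generated by endpoint-fixing directed homotopies; composition is concatenation. For $A\subseteq X$, $\vec\pi_1(X,A)$ is the full subcategory on objects in $A$. For $A\subseteq B\subseteq X$ with inclusion $\iota:\vec\pi_1(X,A)\to\vec\pi_1(X,B)$, a future retract is a functor $P:\vec\pi_1(X,B)\to\vec\pi_1(X,A)$ left adjoint to $\iota$ whose unit satisfies $\eta_a=\mathrm{id}_a$ for $a\in A$. Van Kampen setup: $X$ a d-space, $X_1,X_2\subseteq X$ with $X=\mathrm{Int}(X_1)\cup\mathrm{Int}(X_2)$, dipaths of $X$ the finite concatenations of dipaths of $X_1$ and $X_2$, $X_0=X_1\cap X_2$. For $k=0,1,2$, $A_k\subseteq B_k\subseteq X_k$ with $A_0=A_1\cap A_2$, $B_0=B_1\cap B_2$, $A=A_1\cup A_2$, $B=B_1\cup B_2$, $A=\mathrm{Int}_A(A_1)\cup\mathrm{Int}_A(A_2)$, $B=\mathrm{Int}_B(B_1)\cup\mathrm{Int}_B(B_2)$. Inclusion-induced functors: $i_k:\vec\pi_1(X_0,B_0)\to\vec\pi_1(X_k,B_k)$, $j_k:\vec\pi_1(X_k,B_k)\to\vec\pi_1(X,B)$, $i'_k:\vec\pi_1(X_0,A_0)\to\vec\pi_1(X_k,A_k)$,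 $j'_k:\vec\pi_1(X_k,A_k)\to\vec\pi_1(X,A)$ ($k=1,2$). Compatible future retracts $Q_k:\vec\pi_1(X_k)\to\vec\pi_1(X_k,B_k)$: each a future retract with unit $\theta^k$, commuting with the inclusion-induced functors from index $0$ to $k=1,2$, with $\theta^0_x$ mapping to $\theta^k_x$ for $x\in X_0$. Compatible future retracts $P_k:\vec\pi_1(X_k,B_k)\to\vec\pi_1(X_k,A_k)$: each a future retract with unit $\eta^k$, $P_k\circ i_k=i'_k\circ P_0$ ($k=1,2$), and $\eta^0_x$ mapping to $\eta^k_x$ for $x\in B_0$. *)

(* Defs.v *)
From HB Require Import structures.
From mathcomp Require Import all_boot all_order all_algebra.
From mathcomp Require Import all_classical all_reals topology normedtype.
From mathcomp Require Import lra.
From Stdlib Require Import Relations ClassicalEpsilon.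

Set Implicit Arguments.
Unset Strict Implicit.
Unset Printing Implicit Defensive.
Import Order.TTheory GRing.Theory Num.Theory numFieldNormedType.Exports.
Local Open Scope classical_set_scope.
Local Open Scope ring_scope.

Record precat := PreCat {
  ob : Type;
  hom : ob -> ob -> Type;
  idm : forall a, hom a a;
  comp : forall a b c, hom a b -> hom b c -> hom a c }.
Arguments hom : clear implicits.
Arguments idm {p} a.
Arguments comp {p a b c}.

Definition is_category (C : precat) : Prop :=
  (forall a b (f : hom C a b), comp (idm a) f = f) /\
  (forall a b (f : hom C a b), comp f (idm b) = f) /\
  (forall a b c d (f : hom C a b) (g : hom C b c) (h : hom C c d),
      comp (comp f g) h = comp f (comp g h)).

Record functor (C D : precat) := Functor {
  fobj : ob C -> ob D;
  fmap : forall a b, hom C a b -> hom D (fobj a) (fobj b) }.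
Arguments fobj {C D}.
Arguments fmap {C D} f {a b}.

Definition is_functor (C D : precat) (F : functor C D) : Prop :=
  (forall a, fmap F (idm a) = idm (fobj F a)) /\
  (forall a b c (f : hom C a b) (g : hom C b c),
      fmap F (comp f g) = comp (fmap F f) (fmap F g)).

Definition fcomp (C D E : precat) (F : functor C D) (G : functor D E) :
  functor C E :=
  @Functor C E (fun x => fobj G (fobj F x)) (fun a b f => fmap G (fmap F f)).

(* P : C -> S is a future retract for the inclusion iota : S -> C with unit
   eta: P is left adjoint to iota with unit eta (natural, universal), and
   eta_a = id_a for a in S. *)
Definition is_future_retract (C S : precat) (iota : functor S C)
    (P : functor C S) (eta : forall b : ob C, hom C b (fobj iota (fobj P b))) :
    Prop :=
  is_functor P /\
  (forall b b' (f : hom C b b'),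
      comp f (eta b') = comp (eta b) (fmap iota (fmap P f))) /\
  (forall (b : ob C) (a : ob S) (f : hom C b (fobj iota a)),
      exists! g : hom S (fobj P b) a, comp (eta b) (fmap iota g) = f) /\
  (forall a : ob S,
      existT (fun y => hom C (fobj iota a) y) _ (eta (fobj iota a))
      = existT (fun y => hom C (fobj iota a) y) _ (idm (fobj iota a))).
Arguments is_future_retract {C S} iota P eta.

Definition arrow_pushout (C0 C1 C2 C3 D0 D1 D2 D3 : precat)
  (F0 : functor C0 D0) (F1 : functor C1 D1) (F2 : functor C2 D2)
  (F3 : functor C3 D3)
  (i1 : functor C0 C1) (i2 : functor C0 C2) (j1 : functor C1 C3)
  (j2 : functor C2 C3)
  (i1' : functor D0 D1) (i2' : functor D0 D2) (j1' : functor D1 D3)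
  (j2' : functor D2 D3) : Prop :=
  fcomp i1 j1 = fcomp i2 j2 /\ fcomp i1' j1' = fcomp i2' j2' /\
  fcomp i1 F1 = fcomp F0 i1' /\ fcomp i2 F2 = fcomp F0 i2' /\
  fcomp j1 F3 = fcomp F1 j1' /\ fcomp j2 F3 = fcomp F2 j2' /\
  forall (E E' : precat) (G : functor E E')
         (u1 : functor C1 E) (u2 : functor C2 E)
         (u1' : functor D1 E') (u2' : functor D2 E'),
    is_category E -> is_category E' -> is_functor G ->
    is_functor u1 -> is_functor u2 -> is_functor u1' -> is_functor u2' ->
    fcomp u1 G = fcomp F1 u1' -> fcomp u2 G = fcomp F2 u2' ->
    fcomp i1 u1 = fcomp i2 u2 -> fcomp i1' u1' = fcomp i2' u2' ->
    exists! vv : functor C3 E * functor D3 E',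
      [/\ is_functor vv.1, is_functor vv.2, fcomp vv.1 G = fcomp F3 vv.2,
          fcomp j1 vv.1 = u1 /\ fcomp j2 vv.1 = u2 &
          fcomp j1' vv.2 = u1' /\ fcomp j2' vv.2 = u2'].

Section DSpace.
Variable R : realType.

Definition uI : set R := [set t | 0 <= t <= 1].

Definition is_reparam (phi : R -> R) : Prop :=
  (forall t, uI t -> uI (phi t)) /\ {within uI, continuous phi} /\
  (forall s t, uI s -> uI t -> s <= t -> phi s <= phi t).

(* concatenation of paths (paths are functions R -> X, only their values on
   [0,1] matter) *)
Definition concat (X : Type) (p q : R -> X) : R -> X :=
  fun t => if t <= 2^-1 then p (2 * t) else q (2 * t - 1).

Record dspace (X : topologicalType) := DSpace {
  dipath : (R -> X) -> Prop;
  dipath_cont : forall p, dipath p -> {within uI, continuous p};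
  dipath_const : forall (x : X) p, (forall t, uI t -> p t = x) -> dipath p;
  dipath_reparam : forall p phi q, dipath p -> is_reparam phi ->
      (forall t, uI t -> q t = p (phi t)) -> dipath q;
  dipath_concat : forall p q r, dipath p -> dipath q -> p 1 = q 0 ->
      (forall t, uI t -> r t = concat p q t) -> dipath r }.

Variables (X : topologicalType) (d : dspace X).

Definition dipath_in (Y : set X) (p : R -> X) : Prop :=
  dipath d p /\ forall t, uI t -> Y (p t).

Definition unit_square : set (R * R) := [set z | uI z.1 /\ uI z.2].

(* endpoint-fixing directed homotopy in Y from p to q (paths from a to b):
   a d-map H : ↑I x ↑I -> Y *)
Definition dihomotopy (Y : set X) (a b : X) (p q : R -> X) : Prop :=
  exists H : R -> R -> X,
    {within unit_square, continuous (fun z : R * R => H z.1 z.2)} /\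
    (forall s, uI s -> H s 0 = p s /\ H s 1 = q s) /\
    (forall t, uI t -> H 0 t = a /\ H 1 t = b) /\
    (forall al be, is_reparam al -> is_reparam be ->
        dipath_in Y (fun u => H (al u) (be u))).

Definition dhequiv (Y : set X) (a b : X) : relation (R -> X) :=
  clos_refl_sym_trans _ (dihomotopy Y a b).

Definition dclass (Y : set X) (a b : X) (p : R -> X) : set (R -> X) :=
  [set q | dhequiv Y a b p q].

Definition is_dipath_from (Y : set X) (a b : X) (p : R -> X) : Prop :=
  dipath_in Y p /\ p 0 = a /\ p 1 = b.

Definition pihom (Y : set X) (a b : X) : Type :=
  {C : set (R -> X) | exists p, is_dipath_from Y a b p /\ C = dclass Y a b p}.

Definition rep (Y : set X) (a b : X) (C : pihom Y a b) : R -> X :=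
  proj1_sig (constructive_indefinite_description _ (proj2_sig C)).

Lemma rep_spec (Y : set X) (a b : X) (C : pihom Y a b) :
  is_dipath_from Y a b (rep C).
Proof.
rewrite /rep; case: (constructive_indefinite_description _ _) => p [Hp _] /=.
exact: Hp.
Qed.

Lemma const_spec (Y : set X) (a : X) : Y a ->
  is_dipath_from Y a a (fun _ => a).
Proof.
move=> Ya; split; last by [].
by split=> //; apply: (@dipath_const _ d a).
Qed.

Lemma concat_spec (Y : set X) (a b c : X) (p q : R -> X) :
  is_dipath_from Y a b p -> is_dipath_from Y b c q ->
  is_dipath_from Y a c (concat p q).
Proof.
move=> [[dp Yp] [p0 p1]] [[dq Yq] [q0 q1]].
split; [split|split].
- by apply: (dipath_concat dp dq) => //; rewrite p1 q0.
- move=> t /andP [t0 t1]; rewrite /concat.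
  case: ifP => ht.
  + by apply: Yp; apply/andP; split; lra.
  + have ht' : 2^-1 < t by rewrite ltNge ht.
    by apply: Yq; apply/andP; split; lra.
- by rewrite /concat ifT ?mulr0 // invr_ge0 ler0n.
- rewrite /concat ifF; first by rewrite mulr1 -[X in q (X - _)]/(1 + 1) addrK.
  by apply/negbTE; rewrite -ltNge invf_lt1 ?ltr1n ?ltr0n.
Qed.

Definition pi_id (Y : set X) (a : X) (Ya : Y a) : pihom Y a a :=
  exist _ (dclass Y a a (fun _ => a))
        (ex_intro _ (fun _ => a) (conj (const_spec Ya) erefl)).

Definition pi_comp (Y : set X) (a b c : X) (f : pihom Y a b)
    (g : pihom Y b c) : pihom Y a c :=
  exist _ (dclass Y a c (concat (rep f) (rep g)))
    (ex_intro _ (concat (rep f) (rep g))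
       (conj (concat_spec (rep_spec f) (rep_spec g)) erefl)).

Definition pi1 (Y Z : set X) (hZY : Z `<=` Y) : precat :=
  @PreCat {x : X | Z x} (fun a b => pihom Y (proj1_sig a) (proj1_sig b))
    (fun a => pi_id (hZY _ (proj2_sig a)))
    (fun a b c f g => pi_comp f g).

Lemma dipath_from_sub (Y1 Y2 : set X) (a b : X) (p : R -> X) :
  Y1 `<=` Y2 -> is_dipath_from Y1 a b p -> is_dipath_from Y2 a b p.
Proof. by move=> h [[dp Yp] e]; split=> //; split=> // t /Yp /h. Qed.

Definition incl (Y1 Z1 Y2 Z2 : set X) (h1 : Z1 `<=` Y1) (h2 : Z2 `<=` Y2)
    (hY : Y1 `<=` Y2) (hZ : Z1 `<=` Z2) : functor (pi1 h1) (pi1 h2) :=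
  @Functor (pi1 h1) (pi1 h2)
    (fun x => exist _ (proj1_sig x) (hZ _ (proj2_sig x)))
    (fun a b f => exist _ (dclass Y2 (proj1_sig a) (proj1_sig b) (rep f))
       (ex_intro _ (rep f) (conj (dipath_from_sub hY (rep_spec f)) erefl))).

Definition rel_interior (S T : set X) : set X :=
  [set x | S x /\ exists U, open U /\ U x /\ U `&` S `<=` T].

End DSpace.

Record vk_data (X : topologicalType) := VKData {
  X1 : set X; X2 : set X; A1 : set X; A2 : set X; B1 : set X; B2 : set X;
  hA1B1 : A1 `<=` B1; hA2B2 : A2 `<=` B2;
  hB1X1 : B1 `<=` X1; hB2X2 : B2 `<=` X2 }.

Section VK.
Variables (R : realType) (X : topologicalType) (d : dspace R X)
          (V : vk_data X).

Definition X0 := X1 V `&` X2 V.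
Definition A0 := A1 V `&` A2 V.
Definition B0 := B1 V `&` B2 V.
Definition AU := A1 V `|` A2 V.
Definition BU := B1 V `|` B2 V.

Lemma hB0X0 : B0 `<=` X0. Proof. by move=> x [/(@hB1X1 _ V) h1 /(@hB2X2 _ V) h2]. Qed.
Lemma hA0B0 : A0 `<=` B0. Proof. by move=> x [/(@hA1B1 _ V) h1 /(@hA2B2 _ V) h2]. Qed.
Lemma hA0X0 : A0 `<=` X0. Proof. by move=> x /hA0B0 /hB0X0. Qed.
Lemma hA1X1 : A1 V `<=` X1 V. Proof. by move=> x /(@hA1B1 _ V) /(@hB1X1 _ V). Qed.
Lemma hA2X2 : A2 V `<=` X2 V. Proof. by move=> x /(@hA2B2 _ V) /(@hB2X2 _ V). Qed.
Lemma hAUBU : AU `<=` BU.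
Proof. by move=> x [/(@hA1B1 _ V) h|/(@hA2B2 _ V) h]; [left|right]. Qed.

Definition cX0 := pi1 d (@subset_refl _ X0).
Definition cX1 := pi1 d (@subset_refl _ (X1 V)).
Definition cX2 := pi1 d (@subset_refl _ (X2 V)).
Definition cB0 := pi1 d hB0X0.
Definition cB1 := pi1 d (@hB1X1 _ V).
Definition cB2 := pi1 d (@hB2X2 _ V).
Definition cBX := pi1 d (@subsetT _ BU).
Definition cA0 := pi1 d hA0X0.
Definition cA1 := pi1 d hA1X1.
Definition cA2 := pi1 d hA2X2.
Definition cAX := pi1 d (@subsetT _ AU).

Definition eX1 : functor cX0 cX1 := incl d _ _ (@subIsetl _ _ _) (@subIsetl _ _ _).
Definition eX2 : functor cX0 cX2 := incl d _ _ (@subIsetr _ _ _) (@subIsetr _ _ _).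
Definition i1 : functor cB0 cB1 := incl d _ _ (@subIsetl _ _ _) (@subIsetl _ _ _).
Definition i2 : functor cB0 cB2 := incl d _ _ (@subIsetr _ _ _) (@subIsetr _ _ _).
Definition j1 : functor cB1 cBX := incl d _ _ (@subsetT _ _) (@subsetUl _ _ _).
Definition j2 : functor cB2 cBX := incl d _ _ (@subsetT _ _) (@subsetUr _ _ _).
Definition i1' : functor cA0 cA1 := incl d _ _ (@subIsetl _ _ _) (@subIsetl _ _ _).
Definition i2' : functor cA0 cA2 := incl d _ _ (@subIsetr _ _ _) (@subIsetr _ _ _).
Definition j1' : functor cA1 cAX := incl d _ _ (@subsetT _ _) (@subsetUl _ _ _).
Definition j2' : functor cA2 cAX := incl d _ _ (@subsetT _ _) (@subsetUr _ _ _).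
Definition kB0 : functor cB0 cX0 := incl d _ _ (@subset_refl _ _) hB0X0.
Definition kB1 : functor cB1 cX1 := incl d _ _ (@subset_refl _ _) (@hB1X1 _ V).
Definition kB2 : functor cB2 cX2 := incl d _ _ (@subset_refl _ _) (@hB2X2 _ V).
Definition kA0 : functor cA0 cB0 := incl d _ _ (@subset_refl _ _) hA0B0.
Definition kA1 : functor cA1 cB1 := incl d _ _ (@subset_refl _ _) (@hA1B1 _ V).
Definition kA2 : functor cA2 cB2 := incl d _ _ (@subset_refl _ _) (@hA2B2 _ V).

Definition vk_hyps : Prop :=
  [set: X] = interior (X1 V) `|` interior (X2 V) /\
  (* dipaths of X are finite concatenations of dipaths of X1 and X2 *)
  (forall p, dipath d p ->
     exists (n : nat) (t : nat -> R),
       t 0%N = 0 /\ t n = 1 /\ (forall i, (i < n)%N -> t i < t i.+1) /\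
       forall i, (i < n)%N ->
         (forall s, t i <= s <= t i.+1 -> X1 V (p s)) \/
         (forall s, t i <= s <= t i.+1 -> X2 V (p s))) /\
  AU = rel_interior AU (A1 V) `|` rel_interior AU (A2 V) /\
  BU = rel_interior BU (B1 V) `|` rel_interior BU (B2 V).

Definition compatible_Q (Q0 : functor cX0 cB0) (Q1 : functor cX1 cB1)
  (Q2 : functor cX2 cB2)
  (th0 : forall x : ob cX0, hom cX0 x (fobj kB0 (fobj Q0 x)))
  (th1 : forall x : ob cX1, hom cX1 x (fobj kB1 (fobj Q1 x)))
  (th2 : forall x : ob cX2, hom cX2 x (fobj kB2 (fobj Q2 x))) : Prop :=
  is_future_retract kB0 Q0 th0 /\ is_future_retract kB1 Q1 th1 /\
  is_future_retract kB2 Q2 th2 /\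
  fcomp eX1 Q1 = fcomp Q0 i1 /\ fcomp eX2 Q2 = fcomp Q0 i2 /\
  (forall x : ob cX0,
     existT (fun y => hom cX1 (fobj eX1 x) y) _ (fmap eX1 (th0 x))
     = existT (fun y => hom cX1 (fobj eX1 x) y) _ (th1 (fobj eX1 x))) /\
  (forall x : ob cX0,
     existT (fun y => hom cX2 (fobj eX2 x) y) _ (fmap eX2 (th0 x))
     = existT (fun y => hom cX2 (fobj eX2 x) y) _ (th2 (fobj eX2 x))).

Definition compatible_P (P0 : functor cB0 cA0) (P1 : functor cB1 cA1)
  (P2 : functor cB2 cA2)
  (et0 : forall x : ob cB0, hom cB0 x (fobj kA0 (fobj P0 x)))
  (et1 : forall x : ob cB1, hom cB1 x (fobj kA1 (fobj P1 x)))
  (et2 : forall x : ob cB2, hom cB2 x (fobj kA2 (fobj P2 x))) : Prop :=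
  is_future_retract kA0 P0 et0 /\ is_future_retract kA1 P1 et1 /\
  is_future_retract kA2 P2 et2 /\
  fcomp i1 P1 = fcomp P0 i1' /\ fcomp i2 P2 = fcomp P0 i2' /\
  (forall x : ob cB0,
     existT (fun y => hom cB1 (fobj i1 x) y) _ (fmap i1 (et0 x))
     = existT (fun y => hom cB1 (fobj i1 x) y) _ (et1 (fobj i1 x))) /\
  (forall x : ob cB0,
     existT (fun y => hom cB2 (fobj i2 x) y) _ (fmap i2 (et0 x))
     = existT (fun y => hom cB2 (fobj i2 x) y) _ (et2 (fobj i2 x))).

End VK.

(* Main.v *)
(* Pushouts in the arrow category of Cat are computed levelwise, so it suffices
   that the square of the categories with base points in the [B_k] and the one
   for the [A_k] are pushouts of categories. Both are instances of one
   statement, the second for the composite retractions [P_k] after [Q_k].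

   When all points are base points, a cocone [u_1, u_2] determines the value of
   the induced functor on a dipath: cut the dipath into pieces lying in [X_1] or
   [X_2] and compose the values of the pieces. Two such cuts have a common
   refinement, so the value is well defined. It is invariant under a directed
   homotopy, because a fine enough grid on the square consists of cells mapped
   into some [X_k], and the two boundary paths of a cell are dihomotopic there:
   each dominates the path given by their pointwise minimum.

   For fewer base points, the retractions on the pieces induce a functor on the
   whole by the universal property, and their units glue, naturality being
   checked piece by piece. Since every unit is the identity at a base point, the
   square of base points is a retract of the square of all points, and a retract
   of a pushout square is a pushout. *)
Require Import Defs.
From mathcomp Require Import all_boot all_classical all_reals.
From mathcomp Require Import topology normedtype.
From mathcomp Require Import all_order all_algebra ring lra.
From mathcomp Require interval_inference.
From Stdlib Require Import Relations Eqdep.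

Set Implicit Arguments.
Unset Strict Implicit.
Unset Printing Implicit Defensive.
(* MathComp shadows [hom] and [comp]. *)
Import Defs.
Import Order.TTheory GRing.Theory Num.Theory numFieldNormedType.Exports.
Local Open Scope classical_set_scope.
Local Open Scope ring_scope.

(** * Reparametrizations of the unit interval *)

Section WithinContinuity.
Variables (T U V : topologicalType) (R : realType) (A : set T).

Lemma within_continuous_comp_within (B : set U) (f : T -> U) (g : U -> V) :
  {homo f : x / A x >-> B x} -> {within A, continuous f} ->
  {within B, continuous g} -> {within A, continuous (g \o f)}.
Proof.
move=> fAB /subspace_continuousP cf /subspace_continuousP cg.
apply/subspace_continuousP => x Ax W /(cg _ (fAB _ Ax)) gW.
have : \forall y \near x, A y -> B (f y) -> W (g (f y)) := cf _ Ax _ gW.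
by apply: filterS => y fgy Ay; apply: (fgy Ay); exact: fAB.
Qed.

Lemma within_continuous_pair (f : T -> U) (g : T -> V) :
  {within A, continuous f} -> {within A, continuous g} ->
  {within A, continuous (fun x => (f x, g x))}.
Proof. by move=> cf cg x; apply: cvg_pair; [exact: cf|exact: cg]. Qed.

Lemma within_continuous_if_le (h : T -> R) (c : R) (f g : T -> U) :
  {within A, continuous h} -> {within A, continuous f} ->
  {within A, continuous g} -> (forall x, A x -> h x = c -> f x = g x) ->
  {within A, continuous (fun x => if h x <= c then f x else g x)}.
Proof.
move=> /subspace_continuousP ch /subspace_continuousP cf.
move=> /subspace_continuousP cg fg; apply/subspace_continuousP => x Ax W.
have {}cf : nbhs (f x) W -> \forall y \near x, A y -> W (f y) := cf x Ax W.
have {}cg : nbhs (g x) W -> \forall y \near x, A y -> W (g y) := cg x Ax W.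
have h_near (D : set R) : nbhs (h x) D ->
  \forall y \near x, A y -> D (h y) := ch x Ax D.
change (nbhs (if h x <= c then f x else g x) W ->
  \forall y \near x, A y -> W (if h y <= c then f y else g y)).
have [hxc|hxc|hxc] := ltgtP (h x) c => Wx.
- apply: filterS2 (h_near _ (lt_nbhsl hxc)) (cf Wx) => y hy fy Ay.
  by rewrite (ltW (hy Ay)); exact: fy.
- apply: filterS2 (h_near _ (lt_nbhsr hxc)) (cg Wx) => y hy gy Ay.
  by rewrite leNgt (hy Ay); exact: gy.
- have Wgx : nbhs (g x) W by rewrite -fg.
  by apply: filterS2 (cf Wx) (cg Wgx) => y fy gy Ay; case: ifP; auto.
Qed.

End WithinContinuity.

Section UnitSquare.
Variables (R : realType) (U : topologicalType) (f : R -> U).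
Hypothesis cf : {within @uI R, continuous f}.

Lemma within_square_continuous_fst :
  {within @unit_square R, continuous (fun z : R * R => f z.1)}.
Proof.
apply: (within_continuous_comp_within (f := fst)) cf; first by move=> z [].
by apply: continuous_subspaceT => z; exact: cvg_fst.
Qed.

Lemma within_square_continuous_snd :
  {within @unit_square R, continuous (fun z : R * R => f z.2)}.
Proof.
apply: (within_continuous_comp_within (f := snd)) cf; first by move=> z [].
by apply: continuous_subspaceT => z; exact: cvg_snd.
Qed.

End UnitSquare.

Section Reparametrizations.
Variable R : realType.
Implicit Types (f g al be : R -> R) (c s t u : R).

Lemma uI0 : uI (0 : R). Proof. by rewrite /uI /= lexx ler01. Qed.
Lemma uI1 : uI (1 : R). Proof. by rewrite /uI /= lexx ler01. Qed.
Hint Resolve uI0 uI1 : core.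

Lemma reparam_id : is_reparam (@id R).
Proof.
by split=> //; split=> //; apply: continuous_subspaceT => t; exact: cvg_id.
Qed.

Lemma reparam_cst t : uI t -> is_reparam (fun _ : R => t).
Proof.
move=> t01; split=> //; split=> //.
exact/continuous_subspaceT/cst_continuous.
Qed.

Lemma reparam_comp f g : is_reparam f -> is_reparam g -> is_reparam (g \o f).
Proof.
move=> [f01 [cf fm]] [g01 [cg gm]].
split; first by move=> t /f01 /g01.
split; first exact: within_continuous_comp_within f01 cf cg.
by move=> s t s01 t01 /(fm _ _ s01 t01); apply: gm; exact: f01.
Qed.

Lemma reparam_min f g : is_reparam f -> is_reparam g -> is_reparam (f \min g).
Proof.
move=> [f01 [cf fm]] [g01 [cg gm]].
split; first by move=> t t01 /=; case: leP => _; [exact: f01|exact: g01].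
split; first by move=> t; apply: (@continuous_min _ (subspace (@uI R)) f g t);
  [exact: cf|exact: cg].
move=> s t s01 t01 st /=.
by rewrite le_min !ge_min (fm _ _ s01 t01 st) (gm _ _ s01 t01 st) orbT.
Qed.

Lemma reparam_conv f g t : is_reparam f -> is_reparam g -> uI t ->
  is_reparam (fun u => t * f u + (1 - t) * g u).
Proof.
move=> [f01 [cf fm]] [g01 [cg gm]] /andP[t0 t1]; split; last split.
- by move=> u u01; move: (f01 u u01) (g01 u u01) => /andP[? ?] /andP[? ?];
    apply/andP; split; nra.
- by move=> u; apply: cvgD; apply: cvgM;
    [exact: cst_continuous|exact: cf|exact: cst_continuous|exact: cg].
- by move=> u v u01 v01 uv; have := fm _ _ u01 v01 uv;
    have := gm _ _ u01 v01 uv; nra.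
Qed.

(* Maps of the directed square to the directed interval. *)
Definition is_reparam2 (K : R -> R -> R) : Prop :=
  {within @unit_square R, continuous (fun z : R * R => K z.1 z.2)} /\
  forall al be, is_reparam al -> is_reparam be ->
    is_reparam (fun u => K (al u) (be u)).

Lemma reparam2_uI (K : R -> R -> R) s t : is_reparam2 K -> uI s -> uI t ->
  uI (K s t).
Proof.
by move=> [_ rK] s01 t01;
  case: (rK _ _ (reparam_cst s01) (reparam_cst t01)) => /(_ 0); auto.
Qed.

Definition interp f g s t : R := f s + t * (g s - f s).

Lemma reparam2_interp f g : is_reparam f -> is_reparam g ->
  (forall t, uI t -> f t <= g t) -> is_reparam2 (interp f g).
Proof.
move=> rf rg fg; split.
  have [_ [cf _]] := rf; have [_ [cg _]] := rg.
  have cid : {within @uI R, continuous (@id R)}.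
    by apply: continuous_subspaceT => t; exact: cvg_id.
  move=> z; apply: cvgD; first exact: within_square_continuous_fst cf _.
  apply: cvgM; first exact: within_square_continuous_snd cid _.
  by apply: cvgB; apply: within_square_continuous_fst.
move=> al be ra [b01 [cb bm]].
have [f01 [cf fm]] := reparam_comp ra rf.
have [g01 [cg gm]] := reparam_comp ra rg.
have {}fg t : uI t -> f (al t) <= g (al t) by move=> /(proj1 ra) /fg.
split; last split.
- move=> t t01; have := fg _ t01; move: (f01 _ t01) (g01 _ t01) (b01 _ t01).
  rewrite /uI /interp /= => /andP[? ?] /andP[? ?] /andP[? ?] ?.
  by apply/andP; split; nra.
- move=> t; apply: cvgD; first exact: cf.
  by apply: cvgM; [exact: cb|apply: cvgB; [exact: cg|exact: cf]].
- move=> s t s01 t01 st; move: (b01 _ s01) (b01 _ t01) (bm _ _ s01 t01 st).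
  move: (fg _ s01) (fg _ t01) (fm _ _ s01 t01 st) (gm _ _ s01 t01 st).
  rewrite /interp /= => fgs fgt fst gst /andP[b0 b1] /andP[b0' b1'] bst.
  apply: (@le_trans _ _ (f (al t) + be s * (g (al t) - f (al t)))); nra.
Qed.

Lemma interp_bounds f g s t : is_reparam f -> is_reparam g ->
  (forall t, uI t -> f t <= g t) -> f 1 = g 1 -> uI s -> uI t ->
  f 0 <= interp f g s t <= f 1.
Proof.
move=> [_ [_ fm]] [_ [_ gm]] fg fg1 s01 /andP[t0 t1].
have /andP[s0 s1] := s01.
have := fg _ s01; have := fm _ _ uI0 s01 s0; have := gm _ _ s01 uI1 s1.
by rewrite /interp -fg1 => *; apply/andP; split; nra.
Qed.

Lemma reparam_affine s t : 0 <= s -> s <= t -> t <= 1 ->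
  is_reparam (fun u => s + u * (t - s)).
Proof.
move=> s0 st t1.
have s01 : uI s by apply/andP; split; lra.
have t01 : uI t by apply/andP; split; lra.
have [_] := reparam2_interp (reparam_cst s01) (reparam_cst t01) (fun _ _ => st).
by apply; exact: reparam_id.
Qed.

Definition clamp t : R := Num.max 0 (Num.min 1 t).

Lemma clamp_uI t : uI (clamp t).
Proof. by rewrite /uI /clamp /= le_max lexx ge_max ler01 ge_min lexx. Qed.

Lemma clamp_id t : uI t -> clamp t = t.
Proof. by rewrite /uI /clamp /= => /andP[t0 t1]; rewrite min_r // max_r. Qed.

Lemma clamp_le0 t : t <= 0 -> clamp t = 0.
Proof. by move=> t0; rewrite /clamp min_r ?max_l //; lra. Qed.

Lemma clamp_ge1 t : 1 <= t -> clamp t = 1.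
Proof. by move=> t1; rewrite /clamp min_l ?max_r. Qed.

Lemma clamp_continuous : continuous clamp.
Proof.
move=> t; apply: continuous_max; first exact: cst_continuous.
by apply: continuous_min; [exact: cst_continuous|exact: cvg_id].
Qed.

Lemma reparam_clamp f : continuous f -> {homo f : s t / s <= t} ->
  is_reparam (clamp \o f).
Proof.
move=> cf fm; split; first by move=> t _; exact: clamp_uI.
split.
  apply: continuous_subspaceT => t; apply: continuous_comp; first exact: cf.
  exact: clamp_continuous.
move=> s t _ _ /fm fst; rewrite /clamp /= ge_max !le_max lexx /=.
by rewrite le_min !ge_min lexx fst /= orbT orbT.
Qed.

Lemma reparam_ivt al c : is_reparam al -> al 0 <= c <= al 1 ->
  exists2 u, uI u & al u = c.
Proof.
move=> [_ [cal _]] /andP[al0c cal1].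
have cal' : {within `[0, 1], continuous al}.
  by apply: continuous_subspaceW cal => x; rewrite /= in_itv.
have [|u] := IVT ler01 cal' (v := c).
  by rewrite ge_min le_max al0c cal1 orbT.
by rewrite in_itv; exists u.
Qed.

Lemma reparam_halving c : 0 < c -> c < 1 ->
  exists2 psi, is_reparam psi & forall u, uI u ->
    psi u = if u <= c then u / (2 * c) else 2^-1 + (u - c) / (2 * (1 - c)).
Proof.
move=> c_gt0 c_lt1.
have k0 : 0 < (2 * c)^-1 by rewrite invr_gt0; lra.
have k1 : 0 < (2 * (1 - c))^-1 by rewrite invr_gt0; lra.
have kc : c / (2 * c) = 2^-1 by field; lra.
have kc' : (1 - c) / (2 * (1 - c)) = 2^-1 by field; lra.
pose psi u := Num.min (u / (2 * c)) 2^-1 + Num.max 0 ((u - c) / (2 * (1 - c))).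
exists (clamp \o psi).
  apply: reparam_clamp.
    move=> u; apply: cvgD; [apply: (continuous_min (f := fun u => u / (2 * c)))|
      apply: (continuous_max (g := fun u => (u - c) / (2 * (1 - c))))];
      try exact: cst_continuous; apply: cvgM; try exact: cst_continuous.
      exact: cvg_id.
    by apply: cvgB; [exact: cvg_id|exact: cst_continuous].
  move=> s t st; apply: lerD.
    by rewrite le_min !ge_min lexx orbT andbT ler_pM2r ?st.
  by rewrite ge_max !le_max lexx /= ler_pM2r // lerB ?orbT.
move=> u /andP[u0 u1]; rewrite /= /psi; case: (leP u c) => uc.
  rewrite min_l ?max_l -?kc ?ler_pM2r ?addr0 //;
    last by rewrite pmulr_lle0 //; lra.
  by rewrite clamp_id //; apply/andP; split; [exact: mulr_ge0 (ltW k0)|nra].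
rewrite min_r ?max_r -?kc ?ler_pM2r ?(ltW uc) //; last by apply: mulr_ge0; lra.
rewrite clamp_id // kc; apply/andP; split; nra.
Qed.

End Reparametrizations.
#[local] Hint Resolve uI0 uI1 : core.

Section Halves.
Variable R : realType.
Implicit Types u : R.

Definition fst_half u : R := clamp (2 * u).
Definition snd_half u : R := clamp (2 * u - 1).

Lemma fst_half0 : fst_half 0 = 0.
Proof. by rewrite /fst_half mulr0 clamp_id. Qed.
Lemma fst_half1 : fst_half 1 = 1.
Proof. by rewrite /fst_half clamp_ge1 //; lra. Qed.
Lemma snd_half0 : snd_half 0 = 0.
Proof. by rewrite /snd_half clamp_le0 //; lra. Qed.
Lemma snd_half1 : snd_half 1 = 1.
Proof. by rewrite /snd_half clamp_ge1 //; lra. Qed.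

Lemma reparam_fst_half : is_reparam fst_half.
Proof.
apply: reparam_clamp; last by move=> s t; lra.
by move=> t; apply: cvgM; [exact: cst_continuous|exact: cvg_id].
Qed.

Lemma reparam_snd_half : is_reparam snd_half.
Proof.
apply: reparam_clamp; last by move=> s t; lra.
move=> t; apply: cvgB; last exact: cst_continuous.
by apply: cvgM; [exact: cst_continuous|exact: cvg_id].
Qed.

Variant concat_spec_of (T : Type) (p q : R -> T) u : R -> R -> T -> Prop :=
| ConcatLo of u <= 2^-1 & uI (2 * u) :
    concat_spec_of p q u (2 * u) 0 (p (2 * u))
| ConcatHi of 2^-1 < u & uI (2 * u - 1) :
    concat_spec_of p q u 1 (2 * u - 1) (q (2 * u - 1)).

Lemma concatP (T : Type) (p q : R -> T) u : uI u ->
  concat_spec_of p q u (fst_half u) (snd_half u) (concat p q u).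
Proof.
move=> /andP[u0 u1]; rewrite /fst_half /snd_half /concat; case: (leP u) => hu.
- have u01 : uI (2 * u) by apply/andP; split; lra.
  by rewrite clamp_id ?clamp_le0; [by constructor|lra|].
- have u01 : uI (2 * u - 1) by apply/andP; split; lra.
  by rewrite clamp_ge1 ?clamp_id; [by constructor| |lra].
Qed.

Lemma eq_concat (T : Type) (p q p' q' : R -> T) :
    (forall u, uI u -> p u = p' u) -> (forall u, uI u -> q u = q' u) ->
  forall u, uI u -> concat p q u = concat p' q' u.
Proof.
move=> pp' qq' u u01; have [hu u01'|hu u01'] := concatP p q u01.
  by rewrite pp' // /concat hu.
by rewrite qq' // /concat leNgt hu.
Qed.

Lemma concat_fst_half (T : Type) (p q : R -> T) u : u <= 1 ->
  concat p q (2^-1 * u) = p u.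
Proof.
by move=> u1; rewrite /concat ifT; [congr p; lra|lra].
Qed.

Lemma concat_snd_half (T : Type) (p q : R -> T) u : 0 <= u -> p 1 = q 0 ->
  concat p q (2^-1 + 2^-1 * u) = q u.
Proof.
move=> u0 pq; rewrite /concat; case: ifPn => hu; last by congr q; lra.
have -> : u = 0 by lra.
by rewrite -pq; congr p; lra.
Qed.

End Halves.

(** * Dipaths and directed homotopies *)

Section Dipaths.
Variables (R : realType) (X : topologicalType) (d : dspace R X).
Implicit Types (p q : R -> X) (Y : set X) (a b c : X).

Lemma dipath_ext p q : (forall t, uI t -> q t = p t) -> dipath d p ->
  dipath d q.
Proof. by move=> qp dp; exact: dipath_reparam dp (reparam_id R) qp. Qed.

Lemma is_dipath_from_ext Y a b p q : (forall t, uI t -> q t = p t) ->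
  is_dipath_from d Y a b p -> is_dipath_from d Y a b q.
Proof.
move=> qp [[dp Yp] pab]; split; last by rewrite !qp.
by split; [exact: dipath_ext dp|move=> t t01; rewrite qp //; exact: Yp].
Qed.

Definition subpath p (s t : R) : R -> X := fun u => p (s + u * (t - s)).

Lemma subpath01 p : subpath p 0 1 = p.
Proof. by apply/funext => u; rewrite /subpath add0r subr0 mulr1. Qed.

Lemma subpath_subpath p s t x y :
  subpath (subpath p s t) x y = subpath p (s + x * (t - s)) (s + y * (t - s)).
Proof. by apply/funext => u; rewrite /subpath; congr p; ring. Qed.

Lemma is_dipath_from_subpath Y p s t :
  dipath d p -> 0 <= s -> s <= t -> t <= 1 ->
  (forall u, s <= u <= t -> Y (p u)) ->
  is_dipath_from d Y (p s) (p t) (subpath p s t).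
Proof.
move=> dp s0 st t1 Yp; split; last by rewrite /subpath mul0r addr0 mul1r subrKC.
split; first exact: dipath_reparam dp (reparam_affine s0 st t1) _.
by move=> u /andP[u0 u1]; apply: Yp; apply/andP; split; nra.
Qed.

Lemma dipath_paste p q (c : R) : dipath d p -> dipath d q -> uI c ->
  p c = q c -> dipath d (fun u => if u <= c then p u else q u).
Proof.
move=> dp dq /andP[c_ge0 c_le1] pqc.
have [c0|c_neq0] := eqVneq c 0.
  apply: dipath_ext dq => t /andP[t0 t1]; case: ifP => // tc.
  by have -> : t = c by lra.
have [c1|c_neq1] := eqVneq c 1.
  by apply: dipath_ext dp => t /andP[t0 t1]; rewrite c1 t1.
have c_gt0 : 0 < c by rewrite lt_neqAle eq_sym c_neq0.
have c_lt1 : c < 1 by rewrite lt_neqAle c_neq1.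
have [psi rpsi psiE] := reparam_halving c_gt0 c_lt1.
apply: (dipath_reparam (p := concat (subpath p 0 c) (subpath q c 1)) _ rpsi _).
  apply: (dipath_concat (p := subpath p 0 c) (q := subpath q c 1)) => //.
  - exact: dipath_reparam dp (reparam_affine (lexx 0) c_ge0 c_le1) _.
  - exact: dipath_reparam dq (reparam_affine c_ge0 c_le1 (lexx 1)) _.
  - by rewrite /subpath mul1r mul0r addr0 add0r subr0.
move=> t /psiE ->; case: (leP t c) => tc; rewrite /concat.
- rewrite ifT; last by rewrite ler_pdivrMr; lra.
  by congr p; field; lra.
- rewrite ifF; last by rewrite gerDl leNgt divr_gt0; lra.
  by congr q; field; lra.
Qed.

Lemma dipath_if_le p q (al : R -> R) (c : R) : dipath d p -> dipath d q ->
  is_reparam al -> (forall u, uI u -> al u = c -> p u = q u) ->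
  dipath d (fun u => if al u <= c then p u else q u).
Proof.
move=> dp dq ral pq; have [_ [_ alm]] := ral.
have [al1c|c_lt_al1] := leP (al 1) c.
  apply: dipath_ext dp => u u01; rewrite ifT //.
  by apply: le_trans al1c; apply: alm => //; case/andP: u01.
have [c_lt_al0|al0c] := ltP c (al 0).
  apply: dipath_ext dq => u u01; rewrite ifF //; apply/negbTE; rewrite -ltNge.
  by apply: (lt_le_trans c_lt_al0); apply: alm => //; case/andP: u01.
have [|c' c'01 alc'] := reparam_ivt ral (c := c); first by rewrite al0c ltW.
apply: dipath_ext (dipath_paste dp dq c'01 (pq _ c'01 alc')) => u u01.
have [uc'|c'u] := leP u c'; first by rewrite -alc' ifT //; exact: alm.
have cal : c <= al u by rewrite -alc'; apply: alm => //; exact: ltW.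
by case: leP => // alc; apply: pq => //; apply/eqP; rewrite eq_le alc.
Qed.

Definition square_dmap (H : R -> R -> X) : Prop :=
  {within @unit_square R, continuous (fun z : R * R => H z.1 z.2)} /\
  forall al be, is_reparam al -> is_reparam be ->
    dipath d (fun u => H (al u) (be u)).

Lemma square_dmap_row H t : square_dmap H -> uI t -> dipath d (H^~ t).
Proof. by move=> [_ dH] t01; exact: dH (reparam_id R) (reparam_cst t01). Qed.

Lemma square_dmap_col H s : square_dmap H -> uI s -> dipath d (H s).
Proof. by move=> [_ dH] s01; exact: dH (reparam_cst s01) (reparam_id R). Qed.

Lemma square_dmap_path p : dipath d p -> square_dmap (fun s _ => p s).
Proof.
move=> dp; split; last by move=> al be ral _; exact: dipath_reparam dp ral _.
exact: within_square_continuous_fst (dipath_cont dp).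
Qed.

Lemma square_dmap_comp H K L :
  square_dmap H -> is_reparam2 K -> is_reparam2 L ->
  square_dmap (fun s t => H (K s t) (L s t)).
Proof.
move=> [cH dH] rK rL; split; last first.
  by move=> al be ral rbe; apply: dH; [exact: (proj2 rK)|exact: (proj2 rL)].
apply: (within_continuous_comp_within (f := fun z => (K z.1 z.2, L z.1 z.2)))
  cH.
  by move=> z [z1 z2]; split; exact: reparam2_uI.
exact: within_continuous_pair (proj1 rK) (proj1 rL).
Qed.

Lemma square_dmap_concat H K : square_dmap H -> square_dmap K ->
  (forall t, uI t -> H 1 t = K 0 t) ->
  square_dmap (fun s t => concat (H^~ t) (K^~ t) s).
Proof.
move=> dH dK HK.
have rfst := @reparam_fst_half R; have rsnd := @reparam_snd_half R.
have glueE s t : uI s -> uI t -> concat (H^~ t) (K^~ t) s =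
    if s <= 2^-1 then H (fst_half s) t else K (snd_half s) t.
  by move=> s01 t01; case: (concatP _ _ s01) => hs _; rewrite ?hs // leNgt hs.
have seam s t : uI t -> s = 2^-1 -> H (fst_half s) t = K (snd_half s) t.
  move=> t01 ->.
  by rewrite /fst_half /snd_half clamp_ge1 ?clamp_le0 ?HK //; lra.
have cid : {within @uI R, continuous (@id R)}.
  by apply: continuous_subspaceT => t; exact: cvg_id.
have csquare (G : R -> R -> X) h : square_dmap G -> is_reparam h ->
    {within @unit_square R, continuous (fun z : R * R => G (h z.1) z.2)}.
  move=> [cG _] [h01 [ch _]].
  apply: (within_continuous_comp_within (f := fun z => (h z.1, z.2))) cG.
    by move=> z [z1 z2]; split=> //; exact: h01.
  exact: within_continuous_pair (within_square_continuous_fst ch)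
    (within_square_continuous_snd cid).
split.
  apply: (subspace_eq_continuous (f := fun z : R * R =>
    if z.1 <= 2^-1 then H (fst_half z.1) z.2 else K (snd_half z.1) z.2)).
    by move=> z /set_mem [z1 z2]; rewrite -glueE.
  apply: within_continuous_if_le; [|exact: csquare|exact: csquare|].
    by apply: continuous_subspaceT => z; exact: cvg_fst.
  by move=> z [_ z2]; exact: seam.
move=> al be ral rbe.
apply: dipath_ext (dipath_if_le (c := 2^-1) (al := al) _ _ ral _).
- by move=> u u01; apply: glueE; [exact: (proj1 ral)|exact: (proj1 rbe)].
- exact: (proj2 dH _ _ (reparam_comp ral rfst) rbe).
- exact: (proj2 dK _ _ (reparam_comp ral rsnd) rbe).
- by move=> u u01; apply: seam; exact: (proj1 rbe).
Qed.

Lemma dihomotopyP Y a b p q : dihomotopy d Y a b p q <->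
  exists H, [/\ square_dmap H, forall s t, uI s -> uI t -> Y (H s t),
    forall s, uI s -> H s 0 = p s /\ H s 1 = q s &
    forall t, uI t -> H 0 t = a /\ H 1 t = b].
Proof.
split=> [[H [cH [Hpq [Hab dH]]]]|[H [[cH dH] HY Hpq Hab]]]; exists H.
- split=> //; first by split=> // al be ral rbe; case: (dH al be ral rbe).
  by move=> s t s01 t01;
    case: (dH _ _ (reparam_cst s01) (reparam_cst t01)) => _ /(_ 0); apply.
- split=> //; split=> //; split=> // al be ral rbe.
  by split=> [|u u01];
    [exact: dH|apply: HY; [exact: (proj1 ral)|exact: (proj1 rbe)]].
Qed.

Lemma dihomotopy_sub Y Y' a b p q : Y `<=` Y' ->
  dihomotopy d Y a b p q -> dihomotopy d Y' a b p q.
Proof.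
move=> YY' /dihomotopyP[H [dH HY Hpq Hab]]; apply/dihomotopyP; exists H.
by split=> // s t s01 t01; apply/YY'/HY.
Qed.

Lemma dihomotopy_refl Y a b p q : is_dipath_from d Y a b p ->
  (forall t, uI t -> q t = p t) -> dihomotopy d Y a b p q.
Proof.
move=> [[dp Yp] pab] qp; apply/dihomotopyP; exists (fun s _ => p s).
by split=> //;
  [exact: square_dmap_path|move=> s t s01 _; exact: Yp|move=> s /qp].
Qed.

Lemma dihomotopy_from Y a b p q : dihomotopy d Y a b p q ->
  is_dipath_from d Y a b p /\ is_dipath_from d Y a b q.
Proof.
move=> /dihomotopyP[H [dH HY Hpq Hab]].
have row t : uI t -> is_dipath_from d Y a b (H^~ t).
  move=> t01; split; last exact: Hab.
  by split; [exact: square_dmap_row|move=> s s01; exact: HY].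
split.
- by apply: is_dipath_from_ext (row 0 (uI0 R)) => s /Hpq [].
- by apply: is_dipath_from_ext (row 1 (uI1 R)) => s /Hpq [].
Qed.

Lemma dihomotopy_concat Y a b c p p' q q' :
  dihomotopy d Y a b p p' -> dihomotopy d Y b c q q' ->
  dihomotopy d Y a c (concat p q) (concat p' q').
Proof.
move=> /dihomotopyP[H [dH HY Hpq Hab]] /dihomotopyP[K [dK KY Kpq Kbc]].
apply/dihomotopyP; exists (fun s t => concat (H^~ t) (K^~ t) s); split.
- by apply: square_dmap_concat => // t t01;
    rewrite (proj2 (Hab t t01)) (proj1 (Kbc t t01)).
- by move=> s t s01 t01; case: (concatP _ _ s01) => _ u01;
    [exact: HY|exact: KY].
- by move=> s s01; split; apply: eq_concat => // u u01;
    [case: (Hpq u u01)|case: (Kpq u u01)|case: (Hpq u u01)|case: (Kpq u u01)].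
- move=> t t01; rewrite /concat ifT ?mulr0; [|lra].
  rewrite ifF; last by apply/negbTE; rewrite -ltNge; lra.
  split; first by case: (Hab t t01).
  by have -> : 2 * 1 - 1 = 1 :> R; [lra|case: (Kbc t t01)].
Qed.

End Dipaths.

Section DirectedHomotopy.
Variables (R : realType) (X : topologicalType) (d : dspace R X).
Implicit Types (p q : R -> X) (Y : set X) (a b c : X).

Lemma dihomotopy_interp H Y (f g f' g' : R -> R) : square_dmap d H ->
  is_reparam f -> is_reparam g -> is_reparam f' -> is_reparam g' ->
  (forall u, uI u -> f u <= f' u) -> (forall u, uI u -> g u <= g' u) ->
  f 0 = f' 0 -> g 0 = g' 0 -> f 1 = f' 1 -> g 1 = g' 1 ->
  (forall v w, f 0 <= v <= f 1 -> g 0 <= w <= g 1 -> Y (H v w)) ->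
  dihomotopy d Y (H (f 0) (g 0)) (H (f 1) (g 1))
    (fun u => H (f u) (g u)) (fun u => H (f' u) (g' u)).
Proof.
move=> dH rf rg rf' rg' ff' gg' f0 g0 f1 g1 HY; apply/dihomotopyP.
exists (fun s t => H (interp f f' s t) (interp g g' s t)); split.
- by apply: square_dmap_comp => //; exact: reparam2_interp.
- by move=> s t s01 t01; apply: HY; exact: interp_bounds.
- by move=> s s01; rewrite /interp !mul0r !mul1r !addr0 !subrKC.
- by move=> t t01; rewrite /interp -f0 -g0 -f1 -g1 !subrr !mulr0 !addr0.
Qed.

(* Any two monotone paths with common ends are compared with their minimum. *)
Lemma dhequiv_monotone H Y (f g f' g' : R -> R) : square_dmap d H ->
  is_reparam f -> is_reparam g -> is_reparam f' -> is_reparam g' ->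
  f 0 = f' 0 -> g 0 = g' 0 -> f 1 = f' 1 -> g 1 = g' 1 ->
  (forall v w, f 0 <= v <= f 1 -> g 0 <= w <= g 1 -> Y (H v w)) ->
  dhequiv d Y (H (f 0) (g 0)) (H (f 1) (g 1))
    (fun u => H (f u) (g u)) (fun u => H (f' u) (g' u)).
Proof.
move=> dH rf rg rf' rg' f0 g0 f1 g1 HY.
have rm := reparam_min rf rf'; have rn := reparam_min rg rg'.
have m0 : (f \min f') 0 = f 0 by rewrite /= -f0 minxx.
have m1 : (f \min f') 1 = f 1 by rewrite /= -f1 minxx.
have n0 : (g \min g') 0 = g 0 by rewrite /= -g0 minxx.
have n1 : (g \min g') 1 = g 1 by rewrite /= -g1 minxx.
have min_homotopy h k : is_reparam h -> is_reparam k ->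
    (forall u, uI u -> (f \min f') u <= h u) ->
    (forall u, uI u -> (g \min g') u <= k u) ->
    f 0 = h 0 -> g 0 = k 0 -> f 1 = h 1 -> g 1 = k 1 ->
    dihomotopy d Y (H (f 0) (g 0)) (H (f 1) (g 1))
      (fun u => H ((f \min f') u) ((g \min g') u)) (fun u => H (h u) (k u)).
  move=> rh rk mh nk h0 k0 h1 k1; rewrite -{1}m0 -{1}m1 -{1}n0 -{1}n1.
  by apply: dihomotopy_interp; rewrite ?m0 ?m1 ?n0 ?n1.
apply: (rst_trans _ _ _ (fun u => H ((f \min f') u) ((g \min g') u))).
- by apply/rst_sym/rst_step/min_homotopy => // u _; rewrite /= ge_min lexx.
- by apply/rst_step/min_homotopy => // u _; rewrite /= ge_min lexx orbT.
Qed.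

Lemma dhequiv_reparam Y a b p (f : R -> R) : is_dipath_from d Y a b p ->
  is_reparam f -> f 0 = 0 -> f 1 = 1 -> dhequiv d Y a b p (p \o f).
Proof.
move=> [[dp Yp] [<- <-]] rf f0 f1; have rid := reparam_id R.
apply: (@dhequiv_monotone (fun s _ => p s) Y id id f f); rewrite ?f0 ?f1 //.
  exact: square_dmap_path.
by move=> v w /Yp.
Qed.

Lemma dhequiv_ext Y a b p q : is_dipath_from d Y a b p ->
  (forall t, uI t -> q t = p t) -> dhequiv d Y a b p q.
Proof. by move=> hp qp; exact/rst_step/dihomotopy_refl. Qed.

Lemma dhequiv_from Y a b p q : dhequiv d Y a b p q ->
  is_dipath_from d Y a b p <-> is_dipath_from d Y a b q.
Proof.
by elim=> {p q} [p q /dihomotopy_from []|p|p q _ ->|p q r _ -> _ ->].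
Qed.

Lemma dhequiv_sub Y Y' a b p q : Y `<=` Y' ->
  dhequiv d Y a b p q -> dhequiv d Y' a b p q.
Proof.
move=> YY'; elim=> {p q} [p q pq|p|p q _|p q r _ + _].
- by apply: rst_step; exact: dihomotopy_sub pq.
- exact: rst_refl.
- exact: rst_sym.
- exact: rst_trans.
Qed.

Lemma dhequiv_reparam_ext Y a b p q (f : R -> R) : is_dipath_from d Y a b p ->
  is_reparam f -> f 0 = 0 -> f 1 = 1 -> (forall u, uI u -> q u = p (f u)) ->
  dhequiv d Y a b p q.
Proof.
move=> hp rf f0 f1 qpf; have pf := dhequiv_reparam hp rf f0 f1.
by apply: (rst_trans _ _ _ _ _ pf); apply: dhequiv_ext => //;
  exact/(dhequiv_from pf).
Qed.

Lemma dhequiv_map Y Y' a b a' b' (F : (R -> X) -> R -> X) :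
  (forall p q, dihomotopy d Y a b p q -> dihomotopy d Y' a' b' (F p) (F q)) ->
  forall p q, dhequiv d Y a b p q -> dhequiv d Y' a' b' (F p) (F q).
Proof.
move=> Fdi p q; elim=> {p q} [p q /Fdi|p|p q _|p q r _ + _].
- exact: rst_step.
- exact: rst_refl.
- exact: rst_sym.
- exact: rst_trans.
Qed.

Lemma dhequiv_concat Y a b c p p' q q' :
  is_dipath_from d Y a b p -> is_dipath_from d Y b c q ->
  dhequiv d Y a b p p' -> dhequiv d Y b c q q' ->
  dhequiv d Y a c (concat p q) (concat p' q').
Proof.
move=> hp hq pp' qq'; have hp' := proj1 (dhequiv_from pp') hp.
have concat_l : dhequiv d Y a c (concat p q) (concat p' q).
  apply: (dhequiv_map (F := fun r => concat r q) _ pp') => r r' rr'.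
  exact: dihomotopy_concat rr' (dihomotopy_refl hq _).
apply: (rst_trans _ _ _ _ _ concat_l).
apply: (dhequiv_map _ qq') => r r' rr'.
exact: dihomotopy_concat (dihomotopy_refl hp' _) rr'.
Qed.

Lemma dhequiv_concat_cstl Y a b p : is_dipath_from d Y a b p ->
  dhequiv d Y a b p (concat (fun _ => a) p).
Proof.
move=> hp; apply: (dhequiv_reparam_ext hp (reparam_snd_half R));
  rewrite ?snd_half0 ?snd_half1 // => u u01.
by have [_ [<- _]] := hp; case: concatP.
Qed.

Lemma dhequiv_concat_cstr Y a b p : is_dipath_from d Y a b p ->
  dhequiv d Y a b p (concat p (fun _ => b)).
Proof.
move=> hp; apply: (dhequiv_reparam_ext hp (reparam_fst_half R));
  rewrite ?fst_half0 ?fst_half1 // => u u01.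
by have [_ [_ <-]] := hp; case: concatP.
Qed.

Lemma dhequiv_concatA Y a b c e p q r : is_dipath_from d Y a b p ->
  is_dipath_from d Y b c q -> is_dipath_from d Y c e r ->
  dhequiv d Y a e (concat (concat p q) r) (concat p (concat q r)).
Proof.
move=> hp hq hr; have hpqr := concat_spec (concat_spec hp hq) hr.
have rfst := reparam_fst_half R; have rsnd := reparam_snd_half R.
have half : uI (2^-1 : R) by apply/andP; split; lra.
(* The piecewise linear map with slopes [1/2], [1], [2]. *)
pose f u : R :=
  2^-1 * (2^-1 * fst_half u + (1 - 2^-1) * fst_half (snd_half u)) +
    (1 - 2^-1) * snd_half (snd_half u).
have rf : is_reparam f.
  apply: (reparam_conv _ (reparam_comp rsnd rsnd) half).
  exact: (reparam_conv rfst (reparam_comp rsnd rfst) half).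
apply: (dhequiv_reparam_ext hpqr rf).
- by rewrite /f snd_half0 fst_half0 snd_half0; lra.
- by rewrite /f snd_half1 fst_half1 snd_half1; lra.
move=> u u01; rewrite /f; case: (concatP p _ u01) => hu v01.
  rewrite fst_half0 snd_half0 {1}/concat ifT; last lra.
  by rewrite /concat ifT; [congr p; lra|lra].
case: (concatP q _ v01) => hv w01.
  rewrite {1}/concat ifT; last lra.
  by rewrite /concat ifF; [congr q; lra|apply/negbTE; rewrite -ltNge; lra].
by rewrite /concat ifF; [congr r; lra|apply/negbTE; rewrite -ltNge; lra].
Qed.

Lemma subpath_split Y a b p (x : R) : is_dipath_from d Y a b p -> uI x ->
  dhequiv d Y a b p (concat (subpath p 0 x) (subpath p x 1)).
Proof.
move=> hp x01.
have rf := reparam_conv (reparam_fst_half R) (reparam_snd_half R) x01.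
apply: (dhequiv_reparam_ext hp rf);
  rewrite ?fst_half0 ?snd_half0 ?fst_half1 ?snd_half1; [lra|lra|].
by move=> u u01; case: concatP => // hu _; rewrite /subpath; congr p; lra.
Qed.

Lemma subpath_split_between Y a c p (s t r : R) : s <= t -> t <= r ->
  is_dipath_from d Y a c (subpath p s r) ->
  [/\ is_dipath_from d Y a (p t) (subpath p s t),
      is_dipath_from d Y (p t) c (subpath p t r) &
      dhequiv d Y a c (subpath p s r) (concat (subpath p s t) (subpath p t r))].
Proof.
move=> st tr hsr.
have [x x01 tE] : exists2 x : R, uI x & t = s + x * (r - s).
  have [rs|rs] := eqVneq (r - s) 0; first by exists 0; rewrite // mul0r; lra.
  exists ((t - s) / (r - s)); last by rewrite divfK //; lra.
  by rewrite /uI /= divr_ge0 ?ler_pdivrMr; lra.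
have prefix : subpath (subpath p s r) 0 x = subpath p s t.
  by rewrite subpath_subpath mul0r addr0 -tE.
have suffix : subpath (subpath p s r) x 1 = subpath p t r.
  by rewrite subpath_subpath mul1r subrKC -tE.
have [[dsr Ysr] [sa rc]] := hsr; have /andP[x0 x1] := x01.
have pt : p t = subpath p s r x by rewrite /subpath -tE.
split.
- rewrite -prefix pt -sa; apply: is_dipath_from_subpath => // u /andP[u0 ux].
  by apply: Ysr; apply/andP; split=> //; exact: le_trans x1.
- rewrite -suffix pt -rc; apply: is_dipath_from_subpath => // u /andP[ux u1].
  by apply: Ysr; apply/andP; split=> //; exact: le_trans ux.
- by rewrite -prefix -suffix; exact: subpath_split.
Qed.

Lemma subpath_ends Y a b p (s t : R) : is_dipath_from d Y a b (subpath p s t) ->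
  p s = a /\ p t = b.
Proof. by move=> [_ []]; rewrite /subpath mul0r addr0 mul1r subrKC. Qed.

Lemma dhequiv_square H Y (s0 s1 t0 t1 : R) : square_dmap d H ->
  0 <= s0 -> s0 <= s1 -> s1 <= 1 -> 0 <= t0 -> t0 <= t1 -> t1 <= 1 ->
  (forall v w, s0 <= v <= s1 -> t0 <= w <= t1 -> Y (H v w)) ->
  dhequiv d Y (H s0 t0) (H s1 t1)
    (concat (subpath (H^~ t0) s0 s1) (subpath (H s1) t0 t1))
    (concat (subpath (H s0) t0 t1) (subpath (H^~ t1) s0 s1)).
Proof.
move=> dH s00 s01 s11 t00 t01 t11 HY.
pose f u : R := s0 + u * (s1 - s0); pose g u : R := t0 + u * (t1 - t0).
have rf : is_reparam f by exact: reparam_affine.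
have rg : is_reparam g by exact: reparam_affine.
have rfst := reparam_fst_half R; have rsnd := reparam_snd_half R.
have f0 : f 0 = s0 by rewrite /f mul0r addr0.
have f1 : f 1 = s1 by rewrite /f mul1r subrKC.
have g0 : g 0 = t0 by rewrite /g mul0r addr0.
have g1 : g 1 = t1 by rewrite /g mul1r subrKC.
have := dhequiv_monotone (Y := Y) dH
  (reparam_comp rfst rf) (reparam_comp rsnd rg)
  (reparam_comp rsnd rf) (reparam_comp rfst rg).
rewrite /= !fst_half0 !snd_half0 !fst_half1 !snd_half1 f0 f1 g0 g1 =>
  /(_ erefl erefl erefl erefl HY) HE.
have row t : t0 <= t <= t1 ->
    is_dipath_from d Y (H s0 t) (H s1 t) (subpath (H^~ t) s0 s1).
  move=> ht; apply: (is_dipath_from_subpath (p := H^~ t)) => // [|u /HY];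
    last exact.
  by apply: square_dmap_row => //; apply/andP; split; lra.
have col s : s0 <= s <= s1 ->
    is_dipath_from d Y (H s t0) (H s t1) (subpath (H s) t0 t1).
  move=> hs; apply: is_dipath_from_subpath => //; last by move=> u; exact: HY.
  by apply: square_dmap_col => //; apply/andP; split; lra.
apply: (rst_trans _ _ _ (fun u => H (f (fst_half u)) (g (snd_half u)))).
  apply: dhequiv_ext.
    by apply: concat_spec; [apply: row|apply: col]; rewrite lexx ?s01 ?t01.
  by move=> u u01; case: concatP => // _ _; rewrite ?f1 ?g0.
apply: (rst_trans _ _ _ _ _ HE); apply/rst_sym/dhequiv_ext.
  by apply: concat_spec; [apply: col|apply: row]; rewrite lexx ?s01 ?t01.
by move=> u u01; case: concatP => // _ _; rewrite ?f0 ?g1.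
Qed.

End DirectedHomotopy.

(** * Subdivisions *)

Section Subdivisions.
Variable R : realType.
Implicit Types (P : R -> R -> Prop) (s t : R).

(* [0, 1] is a finite union of consecutive intervals [s, t] with [P s t]. *)
Definition subdivided P : Prop :=
  clos_refl_trans_n1 R (fun s t => [/\ 0 <= s, s <= t, t <= 1 & P s t]) 0 1.

Lemma subdivided_ind P (Q : R -> Prop) : Q 0 ->
  (forall s t, 0 <= s -> s <= t -> t <= 1 -> P s t -> Q s -> Q t) ->
  subdivided P -> Q 1.
Proof. by move=> Q0 QS; elim=> // s t [s0 st t1 Pst] _; exact: QS. Qed.

Lemma subdivided_seq P (n : nat) (t : nat -> R) : t 0%N = 0 -> t n = 1 ->
  (forall i, (i < n)%N -> t i <= t i.+1) ->
  (forall i, (i < n)%N -> P (t i) (t i.+1)) -> subdivided P.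
Proof.
move=> t0 tn tS Pt.
have mono i j : (i <= j)%N -> (j <= n)%N -> t i <= t j.
  move=> /subnK <-; elim: (j - i)%N => // m IH hm.
  by apply: le_trans (IH (ltnW hm)) _; rewrite addSn; exact: tS.
suff reach i : (i <= n)%N -> clos_refl_trans_n1 R
    (fun s t => [/\ 0 <= s, s <= t, t <= 1 & P s t]) 0 (t i).
  by have := reach n (leqnn n); rewrite tn.
elim: i => [_|i IH ltin].
  by rewrite t0; exact: Relation_Operators.rtn1_refl.
apply: (Relation_Operators.rtn1_trans _ _ _ (t i)); last exact: IH (ltnW ltin).
split; last exact: Pt.
- by rewrite -t0; apply: mono => //; exact: ltnW.
- exact: tS.
- by rewrite -tn; exact: mono.
Qed.

Lemma subdivided_uniform P (n : nat) :
  (forall s t, 0 <= s -> s <= t -> t <= 1 -> t <= s + n.+1%:R^-1 -> P s t) ->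
  subdivided P.
Proof.
move=> Pst; have n_gt0 : 0 < n.+1%:R :> R by rewrite ltr0n.
apply: (@subdivided_seq _ n.+1 (fun i => i%:R / n.+1%:R)).
- by rewrite mul0r.
- by rewrite divff // gt_eqF.
- by move=> i _; rewrite ler_pM2r ?invr_gt0 // ler_nat.
move=> i lti; apply: Pst.
- by rewrite divr_ge0 ?ler0n.
- by rewrite ler_pM2r ?invr_gt0 // ler_nat.
- by rewrite ler_pdivrMr // mul1r ler_nat.
- by rewrite -[in X in X <= _]natr1 mulrDl mul1r.
Qed.

Variables (X : topologicalType) (K : Type) (Y : K -> set X).

Definition in_piece (p : R -> X) s t : Prop :=
  exists k, forall u, s <= u <= t -> Y k (p u).

Definition in_cell (H : R -> R -> X) t0 t1 s0 s1 : Prop :=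
  exists k, forall s t, s0 <= s <= s1 -> t0 <= t <= t1 -> Y k (H s t).

Lemma compact_unit_square : compact (@unit_square R).
Proof.
rewrite (_ : @unit_square R = `[0, 1]%classic `*` `[0, 1]%classic).
  by apply: compact_setX; exact: segment_compact.
by apply/seteqP; split=> z; rewrite /unit_square /uI /= !in_itv.
Qed.

Lemma lebesgue_number (H : R -> R -> X) :
    (forall x, exists k, interior (Y k) x) ->
  {within @unit_square R, continuous (fun z : R * R => H z.1 z.2)} ->
  exists n : nat, forall z, unit_square z ->
    exists k, forall w, unit_square w -> `|z.1 - w.1| <= n.+1%:R^-1 ->
      `|z.2 - w.2| <= n.+1%:R^-1 -> Y k (H w.1 w.2).
Proof.
move=> cover /subspace_continuousP cH.
pose small (n : nat) (z : R * R) := exists k, forall w, unit_square w ->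
  `|z.1 - w.1| <= n.+1%:R^-1 -> `|z.2 - w.2| <= n.+1%:R^-1 -> Y k (H w.1 w.2).
suff [n _ small_n] : \forall n \near \oo, @unit_square R `<=` small n.
  by exists n; exact: small_n n (leqnn n).
apply: (proj1 (compact_near_coveringP _) compact_unit_square).
have triangle (x y z e r : R) :
    `|x - y| < r / 2 -> `|y - z| <= e -> e < r / 2 -> `|x - z| < r.
  by have := ler_distD y x z; lra.
move=> z zsq; have [k Yk] := cover (H z.1 z.2).
have /nbhs_ballP[r /= r_gt0 ballY] :
    \forall w \near z, unit_square w -> Y k (H w.1 w.2).
  exact: cH z zsq _ Yk.
have r2_gt0 : 0 < r / 2 by apply: divr_gt0.
exists (ball z (r / 2), [set n : nat | n.+1%:R^-1 < r / 2]) => /=.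
  split; first exact: nbhsx_ballx.
  exact: (near_infty_natSinv_lt (interval_inference.PosNum r2_gt0)).
move=> [w n] [/= [zw1 zw2] nr]; exists k => v vsq wv1 wv2.
have {}nr : n.+1%:R^-1 < r / 2 :> R by [].
by apply: ballY => //; split;
  [exact: triangle zw1 wv1 nr|exact: triangle zw2 wv2 nr].
Qed.

Lemma square_subdivided (H : R -> R -> X) :
    (forall x, exists k, interior (Y k) x) ->
  {within @unit_square R, continuous (fun z : R * R => H z.1 z.2)} ->
  subdivided (fun t0 t1 => subdivided (in_cell H t0 t1)).
Proof.
move=> cover /(lebesgue_number cover)[n hn].
have dist (x y e : R) : x <= y -> y <= x + e -> `|x - y| <= e.
  by move=> ? ?; rewrite ler_distlC; apply/andP; split; lra.
apply: (@subdivided_uniform _ n) => t0 t1 t00 t01 t11 t1n.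
apply: (@subdivided_uniform _ n) => s0 s1 s00 s01 s11 s1n.
have [|k Yk] := hn (s0, t0); first by split; apply/andP; split => /=; lra.
exists k => s t /andP[s0s ss1] /andP[t0t tt1]; apply: (Yk (s, t)).
- by split; apply/andP; split => /=; lra.
- exact: dist s0s (le_trans ss1 s1n).
- exact: dist t0t (le_trans tt1 t1n).
Qed.

End Subdivisions.

(** * Fundamental categories *)

Lemma eq_sval (T : Type) (P : T -> Prop) (a b : {x | P x}) :
  proj1_sig a = proj1_sig b -> a = b.
Proof. by apply: eq_sig_hprop => x; exact: Prop_irrelevance. Qed.

Section Arrows.
Variables (T : Type) (H : T -> T -> Type).

(* Arrows are bundled with their ends in order to compare arrows whose ends are
   only propositionally equal. *)
Definition arr (a b : T) (f : H a b) : {ab : T * T & H ab.1 ab.2} :=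
  existT (fun ab : T * T => H ab.1 ab.2) (a, b) f.

Lemma arr_inj (a b : T) (f g : H a b) : arr f = arr g -> f = g.
Proof. exact: inj_pair2. Qed.

Lemma arr_dom (a b a' b' : T) (f : H a b) (f' : H a' b') : arr f = arr f' ->
  a = a'.
Proof. by move/(congr1 (fun s => (tag s).1)). Qed.

Lemma arr_cod (a b a' b' : T) (f : H a b) (f' : H a' b') : arr f = arr f' ->
  b = b'.
Proof. by move/(congr1 (fun s => (tag s).2)). Qed.

Lemma arr_existT (a b b' : T) (f : H a b) (f' : H a b') :
  existT (H a) b f = existT (H a) b' f' -> arr f = arr f'.
Proof. by move/(congr1 (fun s => arr (tagged s))). Qed.

Lemma arr_retarget (a b a' b' : T) (f : H a b) : a = a' -> b = b' ->
  exists f' : H a' b', arr f' = arr f.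
Proof. by move=> <- <-; exists f. Qed.

Lemma arr_op (op : forall a b c, H a b -> H b c -> H a c) (a b c a' b' c' : T)
    (f : H a b) (g : H b c) (f' : H a' b') (g' : H b' c') :
  arr f = arr f' -> arr g = arr g' -> arr (op _ _ _ f g) = arr (op _ _ _ f' g').
Proof.
move=> ff' gg'; have aa' := arr_dom ff'; have bb' := arr_cod ff'.
have cc' := arr_cod gg'; subst a' b' c'.
by rewrite (arr_inj ff') (arr_inj gg').
Qed.

End Arrows.

Lemma arr_map (T T' : Type) (H : T -> T -> Type) (H' : T' -> T' -> Type)
    (o : T -> T') (F : forall a b, H a b -> H' (o a) (o b)) (a b a' b' : T)
    (f : H a b) (f' : H a' b') :
  arr f = arr f' -> arr (F _ _ f) = arr (F _ _ f').
Proof.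
move=> ff'; have aa' := arr_dom ff'; have bb' := arr_cod ff'; subst a' b'.
by rewrite (arr_inj ff').
Qed.

Section Functors.
Implicit Types B C D E : precat.

Definition fid C : functor C C := Functor (fun a b (f : hom C a b) => f).

Lemma fcompA B C D E (F : functor B C) (G : functor C D) (H : functor D E) :
  fcomp (fcomp F G) H = fcomp F (fcomp G H).
Proof. by []. Qed.

Lemma fcomp1f C D (F : functor C D) : fcomp (fid C) F = F.
Proof. by case: F. Qed.

Lemma arr_fmap C D (F G : functor C D) a b (f : hom C a b) :
  F = G -> arr (fmap F f) = arr (fmap G f).
Proof. by move=> ->. Qed.

Lemma functor_ext C D (F G : functor C D) :
  (forall a b (f : hom C a b), arr (fmap F f) = arr (fmap G f)) -> F = G.
Proof.
case: F G => [o m] [o' m'] /= FG.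
have oo' : o = o' by apply/funext => a; exact: arr_dom (FG a a (idm a)).
subst o'; congr Functor.
apply: functional_extensionality_dep => a.
apply: functional_extensionality_dep => b.
by apply: functional_extensionality_dep => f; exact: arr_inj (FG a b f).
Qed.

Lemma is_functor_fcomp C D E (F : functor C D) (G : functor D E) :
  is_functor F -> is_functor G -> is_functor (fcomp F G).
Proof.
move=> [F1 FM] [G1 GM]; split; first by move=> a /=; rewrite F1 G1.
by move=> a b c f g /=; rewrite FM GM.
Qed.

End Functors.

Section FundamentalCategory.
Variables (R : realType) (X : topologicalType) (d : dspace R X).
Implicit Types (p q : R -> X) (Y Z : set X) (a b c : X).

Definition pi_class Y a b p (hp : is_dipath_from d Y a b p) : pihom d Y a b :=
  exist _ (dclass d Y a b p) (ex_intro _ p (conj hp erefl)).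

Lemma eq_pi_class Y a b p q (hp : is_dipath_from d Y a b p)
    (hq : is_dipath_from d Y a b q) :
  dhequiv d Y a b p q -> pi_class hp = pi_class hq.
Proof.
move=> pq; apply: eq_sval; apply/seteqP; split=> r /=.
- by apply: rst_trans; exact: rst_sym.
- exact: rst_trans.
Qed.

Lemma rep_class Y a b (f : pihom d Y a b) :
  proj1_sig f = dclass d Y a b (rep f).
Proof.
by rewrite /rep;
  case: (ClassicalEpsilon.constructive_indefinite_description _ _) => p [].
Qed.

Lemma pi_class_rep Y a b (f : pihom d Y a b) : pi_class (rep_spec f) = f.
Proof. by apply: eq_sval; rewrite /= -rep_class. Qed.

Lemma rep_pi_class Y a b p (hp : is_dipath_from d Y a b p) :
  dhequiv d Y a b (rep (pi_class hp)) p.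
Proof.
change (dclass d Y a b (rep (pi_class hp)) p).
by rewrite -rep_class; exact: rst_refl.
Qed.

Lemma pi_comp_class Y a b c p q (hp : is_dipath_from d Y a b p)
    (hq : is_dipath_from d Y b c q) :
  pi_comp (pi_class hp) (pi_class hq) = pi_class (concat_spec hp hq).
Proof.
by apply: eq_pi_class; apply: dhequiv_concat;
  [exact: rep_spec|exact: rep_spec|exact: rep_pi_class|exact: rep_pi_class].
Qed.

Lemma pi_comp1l Y a b (Ya : Y a) (f : pihom d Y a b) :
  pi_comp (pi_id d Ya) f = f.
Proof.
rewrite -(pi_class_rep f) (pi_comp_class (const_spec d Ya)).
by apply/eq_pi_class/rst_sym/dhequiv_concat_cstl/rep_spec.
Qed.

Lemma pi_comp1r Y a b (Yb : Y b) (f : pihom d Y a b) :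
  pi_comp f (pi_id d Yb) = f.
Proof.
rewrite -(pi_class_rep f) (pi_comp_class _ (const_spec d Yb)).
by apply/eq_pi_class/rst_sym/dhequiv_concat_cstr/rep_spec.
Qed.

Lemma pi_compA Y a b c e (f : pihom d Y a b) (g : pihom d Y b c)
    (h : pihom d Y c e) :
  pi_comp (pi_comp f g) h = pi_comp f (pi_comp g h).
Proof.
rewrite -(pi_class_rep f) -(pi_class_rep g) -(pi_class_rep h) !pi_comp_class.
by apply: eq_pi_class; apply: dhequiv_concatA; exact: rep_spec.
Qed.

Lemma pi1_category Y Z (hZ : Z `<=` Y) : is_category (pi1 d hZ).
Proof.
split; first by move=> a b f; exact: pi_comp1l.
by split=> *; [exact: pi_comp1r|exact: pi_compA].
Qed.

Lemma pihom_dom Y a b (f : pihom d Y a b) : Y a.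
Proof.
by have [[_ Yf] [fa _]] := rep_spec f; rewrite -[X in Y X]fa; exact: Yf (uI0 R).
Qed.

Lemma pihom_cod Y a b (f : pihom d Y a b) : Y b.
Proof.
by have [[_ Yf] [_ fb]] := rep_spec f; rewrite -[X in Y X]fb; exact: Yf (uI1 R).
Qed.

Definition full_hom Y a b (f : pihom d Y a b) :
    hom (pi1 d (@subset_refl _ Y)) (exist _ a (pihom_dom f))
      (exist _ b (pihom_cod f)) :=
  f.

Definition pi_widen Y Y' (hY : Y `<=` Y') a b (f : pihom d Y a b) :
  pihom d Y' a b :=
  pi_class (dipath_from_sub hY (rep_spec f)).

Lemma pi_widen_class Y Y' (hY : Y `<=` Y') a b p (hp : is_dipath_from d Y a b p)
    (hp' : is_dipath_from d Y' a b p) :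
  pi_widen hY (pi_class hp) = pi_class hp'.
Proof. by apply/eq_pi_class/(dhequiv_sub hY)/rep_pi_class. Qed.

Lemma pi_widen_refl Y (hY : Y `<=` Y) a b (f : pihom d Y a b) :
  pi_widen hY f = f.
Proof. by rewrite -[RHS]pi_class_rep; apply/eq_pi_class/rst_refl. Qed.

Lemma pi_widen_widen Y Y' Y'' (h : Y `<=` Y') (h' : Y' `<=` Y'')
    (h'' : Y `<=` Y'') a b (f : pihom d Y a b) :
  pi_widen h' (pi_widen h f) = pi_widen h'' f.
Proof. exact: pi_widen_class. Qed.

Lemma pi_widen_comp Y Y' (hY : Y `<=` Y') a b c (f : pihom d Y a b)
    (g : pihom d Y b c) :
  pi_widen hY (pi_comp f g) = pi_comp (pi_widen hY f) (pi_widen hY g).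
Proof. by rewrite [RHS]pi_comp_class; exact: pi_widen_class. Qed.

Lemma pi_widen_id Y Y' (hY : Y `<=` Y') a (Ya : Y a) (Ya' : Y' a) :
  pi_widen hY (pi_id d Ya) = pi_id d Ya'.
Proof. exact: pi_widen_class. Qed.

Lemma pi_comp_subpath Y a b c p (s t r : R)
    (hst : is_dipath_from d Y a b (subpath p s t))
    (htr : is_dipath_from d Y b c (subpath p t r))
    (hsr : is_dipath_from d Y a c (subpath p s r)) : s <= t -> t <= r ->
  pi_class hsr = pi_comp (pi_class hst) (pi_class htr).
Proof.
move=> st tr; rewrite pi_comp_class; apply: eq_pi_class.
by have [] := subpath_split_between st tr hsr.
Qed.

End FundamentalCategory.

Local Notation pi_arr f := (@arr _ (pihom _ _) _ _ f).
Local Notation pi_widenT f := (pi_widen (@subsetT _ _) f).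
Local Notation pi1_full d Y := (pi1 d (@subset_refl _ Y)).
Local Notation incl_full d Y :=
  (incl d (@subset_refl _ Y) (@subset_refl _ [set: _]) (@subsetT _ Y)
  (@subsetT _ Y)).
Local Notation inclIl d h0 h1 :=
  (incl d h0 h1 (@subIsetl _ _ _) (@subIsetl _ _ _)).
Local Notation inclIr d h0 h2 :=
  (incl d h0 h2 (@subIsetr _ _ _) (@subIsetr _ _ _)).
Local Notation inclUl d h1 Z2 :=
  (incl d h1 (@subsetT _ (_ `|` Z2)) (@subsetT _ _) (@subsetUl _ _ _)).
Local Notation inclUr d h2 Z1 :=
  (incl d h2 (@subsetT _ (Z1 `|` _)) (@subsetT _ _) (@subsetUr _ _ _)).

Section Inclusions.
Variables (R : realType) (X : topologicalType) (d : dspace R X).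
Implicit Types (Y Z : set X).

Lemma arr_pi1P Y Z (hZ : Z `<=` Y) (a b a' b' : ob (pi1 d hZ))
    (f : hom (pi1 d hZ) a b) (f' : hom (pi1 d hZ) a' b') :
  arr f = arr f' <-> pi_arr f = pi_arr f'.
Proof.
split=> ff'.
  have aa' := arr_dom ff'; have bb' := arr_cod ff'; subst a' b'.
  by congr arr; exact: arr_inj ff'.
have aa' := eq_sval (arr_dom ff'); have bb' := eq_sval (arr_cod ff').
subst a' b'.
by congr arr; exact: arr_inj ff'.
Qed.

Lemma arr_fmap_pi Y Z (hZ : Z `<=` Y) (E : precat) (F : functor (pi1 d hZ) E)
    (a b a' b' : ob (pi1 d hZ)) (f : hom (pi1 d hZ) a b)
    (f' : hom (pi1 d hZ) a' b') :
  pi_arr f = pi_arr f' -> arr (fmap F f) = arr (fmap F f').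
Proof. by move/arr_pi1P; exact: (arr_map (@fmap _ _ F)). Qed.

Lemma pi_arr_id Y (a b : X) (Ya : Y a) (Yb : Y b) : a = b ->
  pi_arr (pi_id d Ya) = pi_arr (pi_id d Yb).
Proof. by move=> ab; subst b; rewrite (Prop_irrelevance Ya Yb). Qed.

Lemma is_functor_incl Y1 Z1 Y2 Z2 (h1 : Z1 `<=` Y1) (h2 : Z2 `<=` Y2)
    (hY : Y1 `<=` Y2) (hZ : Z1 `<=` Z2) : is_functor (incl d h1 h2 hY hZ).
Proof. by split=> [a|a b c f g]; [exact: pi_widen_id|exact: pi_widen_comp]. Qed.

Lemma pi_widen_incl Y Y' Z Z' (h : Z `<=` Y) (h' : Z' `<=` Y') (hY : Y `<=` Y')
    (hZ : Z `<=` Z') (a b : ob (pi1 d h)) (f : hom (pi1 d h) a b)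
    (a' b' : ob (pi1 d h')) (f' : hom (pi1 d h') a' b') :
  arr (fmap (incl d h h' hY hZ) f) = arr f' ->
  pi_arr (pi_widen (@subsetT _ Y') f') = pi_arr (pi_widen (@subsetT _ Y) f).
Proof.
move/arr_pi1P/(arr_map (@pi_widen _ _ d _ _ (@subsetT _ Y'))) => <-.
by congr arr; exact: pi_widen_widen.
Qed.

Lemma incl_irr Y1 Z1 Y2 Z2 (h1 : Z1 `<=` Y1) (h2 : Z2 `<=` Y2)
    (hY hY' : Y1 `<=` Y2) (hZ hZ' : Z1 `<=` Z2) :
  incl d h1 h2 hY hZ = incl d h1 h2 hY' hZ'.
Proof. by rewrite (Prop_irrelevance hY hY') (Prop_irrelevance hZ hZ'). Qed.

Lemma incl_comp Y1 Z1 Y2 Z2 Y3 Z3 (h1 : Z1 `<=` Y1) (h2 : Z2 `<=` Y2)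
    (h3 : Z3 `<=` Y3) (hY12 : Y1 `<=` Y2) (hZ12 : Z1 `<=` Z2)
    (hY23 : Y2 `<=` Y3) (hZ23 : Z2 `<=` Z3) :
  fcomp (incl d h1 h2 hY12 hZ12) (incl d h2 h3 hY23 hZ23) =
  incl d h1 h3 (subset_trans hY12 hY23) (subset_trans hZ12 hZ23).
Proof.
by apply: functor_ext => a b f; apply/arr_pi1P; congr arr;
  exact: pi_widen_widen.
Qed.

End Inclusions.

(** * Transport along dipaths *)

Section Pieces.
Variables (R : realType) (X : topologicalType) (d : dspace R X).
Variables (K : Type) (Y : K -> set X).
Hypothesis cover : forall x, exists k, interior (Y k) x.
Hypothesis pieces : forall p, dipath d p -> subdivided (in_piece Y p).

Lemma pi_class_cst (Z : set X) a p (Za : Z a) (hp : is_dipath_from d Z a a p) :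
  (forall t, uI t -> p t = a) -> pi_class hp = pi_id d Za.
Proof.
by move=> pa; apply/eq_pi_class/rst_sym/dhequiv_ext => //; exact: const_spec.
Qed.

Lemma pihom_piece_ind (P : forall a b, pihom d setT a b -> Prop) :
  (forall a (Ta : [set: X] a), P a a (pi_id d Ta)) ->
  (forall a b c (f : pihom d setT a b) k (g : pihom d (Y k) b c), P a b f ->
    P a c (pi_comp f (pi_widenT g))) ->
  forall a b f, P a b f.
Proof.
move=> P_id P_comp a b f; have [[dp _] [pa pb]] := rep_spec f.
set p := rep f in dp pa pb.
have subpath_from s t : 0 <= s -> s <= t -> t <= 1 ->
    is_dipath_from d setT (p s) (p t) (subpath p s t).
  by move=> s0 st t1; exact: is_dipath_from_subpath.
suff prefix : forall x (hx : is_dipath_from d setT a x (subpath p 0 1)),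
  P a x (pi_class hx).
  have := prefix b; rewrite subpath01 => /(_ (rep_spec f)).
  by rewrite pi_class_rep.
pose Q t := forall x (hx : is_dipath_from d setT a x (subpath p 0 t)),
  P a x (pi_class hx).
apply: (@subdivided_ind R (in_piece Y p) Q) (pieces dp) =>
  [x hx|s t s0 st t1 [k Yk] IH x hx].
  have [_ px] := subpath_ends hx; rewrite pa in px; subst x.
  rewrite (@pi_class_cst setT a _ Logic.I) // => u _.
  by rewrite /subpath subrr mulr0 addr0.
have [_ px] := subpath_ends hx; subst x.
have hs : is_dipath_from d setT a (p s) (subpath p 0 s).
  by rewrite -pa; apply: subpath_from => //; exact: le_trans t1.
have hst := is_dipath_from_subpath dp s0 st t1 Yk.
rewrite (pi_comp_subpath hs (dipath_from_sub (@subsetT _ (Y k)) hst) hx s0 st).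
rewrite -(pi_widen_class (@subsetT _ (Y k)) hst); exact: P_comp.
Qed.

Variables (E : precat) (catE : is_category E) (obj : X -> ob E).
Variable act : forall k a b, pihom d (Y k) a b -> hom E (obj a) (obj b).
Hypothesis act_id : forall k a (Ya : Y k a), act (pi_id d Ya) = idm (obj a).
Hypothesis act_comp :
  forall k a b c (f : pihom d (Y k) a b) (g : pihom d (Y k) b c),
  act (pi_comp f g) = comp (act f) (act g).
Hypothesis act_agree : forall k l a b p (hk : is_dipath_from d (Y k) a b p)
  (hl : is_dipath_from d (Y l) a b p), act (pi_class hk) = act (pi_class hl).

Let comp1m a b (m : hom E a b) : comp (idm a) m = m.
Proof. exact: (proj1 catE). Qed.
Let compm1 a b (m : hom E a b) : comp m (idm b) = m.
Proof. exact: (proj1 (proj2 catE)). Qed.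
Let compA a b c e (m : hom E a b) (n : hom E b c) (o : hom E c e) :
  comp (comp m n) o = comp m (comp n o).
Proof. exact: (proj2 (proj2 catE)). Qed.

(* The value [m] on the segment of [p] over [s, t], computed from some cut of it
   into pieces; independence of the cut is [transport_unique]. *)
Inductive transport (p : R -> X) (s : R) (a : X) :
    R -> forall b, hom E (obj a) (obj b) -> Prop :=
| transport_refl : p s = a -> transport p s s (idm (obj a))
| transport_snoc t b (m : hom E (obj a) (obj b)) r c k
    (h : is_dipath_from d (Y k) b c (subpath p t r)) :
    t <= r -> transport p s t m ->
    transport p s r (comp m (act (pi_class h))).

Lemma transport_ends p s a t b (m : hom E (obj a) (obj b)) :
  transport p s t m -> [/\ s <= t, p s = a & p t = b].
Proof.
elim=> {t b m} [pa|t b m r c k h tr _ [st pa _]]; first by [].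
by split=> //; [exact: le_trans tr|case: (subpath_ends h)].
Qed.

Lemma act_cst k a p (h : is_dipath_from d (Y k) a a p) :
  (forall t, uI t -> p t = a) -> act (pi_class h) = idm (obj a).
Proof. by move=> pa; rewrite (pi_class_cst (pihom_dom (pi_class h))). Qed.

Lemma transport_local p s a t b (m : hom E (obj a) (obj b)) k
    (h : is_dipath_from d (Y k) a b (subpath p s t)) :
  transport p s t m -> m = act (pi_class h).
Proof.
move=> pm; elim: pm k h => {t b m} [pa|t b m r c l h tr pm IH] k h'.
  rewrite act_cst // => u _.
  by rewrite /subpath subrr mulr0 addr0.
have [st _ pt] := transport_ends pm; subst b.
have [h1 h2 _] := subpath_split_between st tr h'.
by rewrite (pi_comp_subpath h1 h2 h') // act_comp -(IH _ h1) (act_agree h2 h).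
Qed.

Lemma transport_split p s a r c (m : hom E (obj a) (obj c)) t :
  transport p s r m -> s <= t -> t <= r ->
  exists (m1 : hom E (obj a) (obj (p t))) (m2 : hom E (obj (p t)) (obj c)),
    [/\ transport p s t m1, transport p t r m2 & m = comp m1 m2].
Proof.
move=> pm st; elim: pm => {r c m} [pa|q b m r c k h qr pm IH] tr.
  have ts : t = s by apply/eqP; rewrite eq_le st tr.
  subst t a; exists (idm _), (idm _); rewrite compm1.
  by split=> //; exact: transport_refl.
have [tq|/ltW qt] := leP t q.
  have [m1 [m2 [pm1 pm2 ->]]] := IH tq.
  exists m1, (comp m2 (act (pi_class h))); rewrite compA.
  by split=> //; exact: transport_snoc.
have [h1 h2 _] := subpath_split_between qt tr h.
exists (comp m (act (pi_class h1))), (comp (idm _) (act (pi_class h2))).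
split; first exact: transport_snoc.
  by apply: transport_snoc => //; exact: transport_refl.
by rewrite comp1m compA -act_comp -(pi_comp_subpath h1 h2 h).
Qed.

Lemma transport_unique p s a t b (m n : hom E (obj a) (obj b)) :
  transport p s t m -> transport p s t n -> m = n.
Proof.
move=> pm; elim: pm n => {t b m} [pa|t b m r c k h tr pm IH] n pn.
  have [k /interior_subset Ya] := cover a.
  have h : is_dipath_from d (Y k) a a (subpath p s s).
    apply: is_dipath_from_ext (const_spec d Ya) => u _.
    by rewrite /subpath subrr mulr0 addr0.
  by rewrite (transport_local h pn) (transport_local h (transport_refl pa)).
have [st _ pt] := transport_ends pm; subst b.
have [n1 [n2 [pn1 pn2 ->]]] := transport_split pn st tr.
by rewrite (IH _ pn1) (transport_local h pn2).
Qed.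

Lemma transport_exists a b p : is_dipath_from d setT a b p ->
  exists m : hom E (obj a) (obj b), transport p 0 1 m.
Proof.
move=> [[dp _] [<- <-]].
apply: (@subdivided_ind R (in_piece Y p)
  (fun t => exists m : hom E (obj (p 0)) (obj (p t)), transport p 0 t m))
  (pieces dp).
  by exists (idm _); exact: transport_refl.
move=> s t s0 st t1 [k Yk] [m pm].
exists (comp m (act (pi_class (is_dipath_from_subpath dp s0 st t1 Yk)))).
exact: transport_snoc.
Qed.

Lemma transport_affine p q (x y s t : R) a b (m : hom E (obj a) (obj b)) :
  0 <= y -> (forall u, s <= u <= t -> p (x + y * u) = q u) ->
  transport q s t m -> transport p (x + y * s) (x + y * t) m.
Proof.
move=> y0 + qm; elim: qm => {t b m} [qa|t b m r c k h tr qm IH] pq.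
  by apply: transport_refl; rewrite pq ?lexx.
have [st _ _] := transport_ends qm.
have pqr u : uI u -> subpath p (x + y * t) (x + y * r) u = subpath q t r u.
  move=> /andP[u0 u1]; rewrite /subpath -pq; first by congr p; ring.
  by apply/andP; split; nra.
have h' := is_dipath_from_ext pqr h.
rewrite (eq_pi_class h h' (dhequiv_ext h pqr)); apply: transport_snoc.
  by rewrite lerD2l ler_wpM2l.
by apply: IH => u /andP[su ut]; rewrite pq // su (le_trans ut).
Qed.

Lemma transport_ext a b p q (m : hom E (obj a) (obj b)) :
  (forall u, uI u -> q u = p u) -> transport p 0 1 m -> transport q 0 1 m.
Proof.
move=> qp /(@transport_affine q p 0 1 0 1).
rewrite mulr0 !add0r mulr1; apply=> // u u01.
by rewrite mul1r add0r qp.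
Qed.

Lemma transport_trans p s t r a b c (m : hom E (obj a) (obj b))
    (n : hom E (obj b) (obj c)) :
  transport p s t m -> transport p t r n -> transport p s r (comp m n).
Proof.
move=> pm; elim=> {r c n} [_|q c n r e k h qr _ IH]; first by rewrite compm1.
by rewrite -compA; exact: transport_snoc.
Qed.

Lemma transport_concat a b c p q (m : hom E (obj a) (obj b))
    (n : hom E (obj b) (obj c)) :
  transport p 0 1 m -> transport q 0 1 n ->
  transport (concat p q) 0 1 (comp m n).
Proof.
move=> pm qn; have [_ _ p1] := transport_ends pm.
have [_ q0 _] := transport_ends qn.
have half_ge0 : 0 <= 2^-1 :> R by lra.
apply: (@transport_trans _ _ 2^-1).
  have := @transport_affine (concat p q) p 0 2^-1 0 1 a b m half_ge0.
  rewrite mulr0 mulr1 !add0r; apply=> // u /andP[_ u1].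
  by rewrite add0r; exact: concat_fst_half.
have := @transport_affine (concat p q) q 2^-1 2^-1 0 1 b c n half_ge0.
have -> : 2^-1 + 2^-1 * 1 = 1 :> R by lra.
by rewrite mulr0 addr0; apply=> // u /andP[u0 _]; rewrite concat_snd_half // p1.
Qed.

Lemma transport_piece k a b p (h : is_dipath_from d (Y k) a b p) :
  transport p 0 1 (act (pi_class h)).
Proof.
have h' : is_dipath_from d (Y k) a b (subpath p 0 1) by rewrite subpath01.
have -> : pi_class h = pi_class h'.
  by apply: eq_pi_class; rewrite subpath01; exact: rst_refl.
rewrite -[act _]comp1m; apply: transport_snoc ler01 _; apply: transport_refl.
by case: h => _ [].
Qed.

(* The edges of the rectangle [0, s] x [t0, t1] commute with the values [mb] and
   [mt] of the transports along its bottom and its top. *)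
Definition ladder (H : R -> R -> X) (t0 t1 s : R) a x y
    (mb : hom E (obj a) (obj x)) (mt : hom E (obj a) (obj y)) : Prop :=
  [/\ transport (H^~ t0) 0 s mb, transport (H^~ t1) 0 s mt &
    forall k (h : is_dipath_from d (Y k) x y (subpath (H s) t0 t1)),
      comp mb (act (pi_class h)) = mt].

Lemma ladder_cell (H : R -> R -> X) (t0 t1 s0 s1 : R) a x y
    (mb : hom E (obj a) (obj x)) (mt : hom E (obj a) (obj y)) :
  square_dmap d H ->
  0 <= s0 -> s0 <= s1 -> s1 <= 1 -> 0 <= t0 -> t0 <= t1 -> t1 <= 1 ->
  in_cell Y H t0 t1 s0 s1 -> ladder H t0 t1 s0 mb mt ->
  exists x' y' (mb' : hom E (obj a) (obj x')) (mt' : hom E (obj a) (obj y')),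
    ladder H t0 t1 s1 mb' mt'.
Proof.
move=> dH s00 s01 s11 t00 t01 t11 [k Yk] [bot top rung].
have [_ _ /= xE] := transport_ends bot; have [_ _ /= yE] := transport_ends top.
subst x y; have row t : t0 <= t <= t1 ->
    is_dipath_from d (Y k) (H s0 t) (H s1 t) (subpath (H^~ t) s0 s1).
  move=> ht; apply: (is_dipath_from_subpath (p := H^~ t)) => // [|s /Yk];
    last exact.
  by apply: square_dmap_row => //; apply/andP; split; lra.
have col s : s0 <= s <= s1 ->
    is_dipath_from d (Y k) (H s t0) (H s t1) (subpath (H s) t0 t1).
  move=> hs; apply: is_dipath_from_subpath => // [|t]; last exact: Yk.
  by apply: square_dmap_col => //; apply/andP; split; lra.
have ht0 : t0 <= t0 <= t1 by rewrite lexx.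
have ht1 : t0 <= t1 <= t1 by rewrite lexx t01.
have hs0 : s0 <= s0 <= s1 by rewrite lexx.
have hs1 : s0 <= s1 <= s1 by rewrite lexx s01.
have square : comp (act (pi_class (row _ ht0))) (act (pi_class (col _ hs1))) =
    comp (act (pi_class (col _ hs0))) (act (pi_class (row _ ht1))).
  by rewrite -!act_comp !pi_comp_class; congr act;
    apply/eq_pi_class/dhequiv_square.
exists _, _, (comp mb (act (pi_class (row _ ht0)))),
  (comp mt (act (pi_class (row _ ht1)))).
split; [exact: transport_snoc|exact: transport_snoc|move=> l h].
by rewrite (act_agree h (col _ hs1)) compA square -compA rung.
Qed.

Lemma transport_strip (H : R -> R -> X) (t0 t1 : R) a b
    (m : hom E (obj a) (obj b)) :
  square_dmap d H -> 0 <= t0 -> t0 <= t1 -> t1 <= 1 ->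
  (forall t, uI t -> H 0 t = a /\ H 1 t = b) ->
  subdivided (in_cell Y H t0 t1) ->
  transport (H^~ t0) 0 1 m -> transport (H^~ t1) 0 1 m.
Proof.
move=> dH t00 t01 t11 Hab cells bot_m.
have t0_uI : uI t0 by apply/andP; split; lra.
have t1_uI : uI t1 by apply/andP; split; lra.
have col_cst s c k (h : is_dipath_from d (Y k) c c (subpath (H s) t0 t1)) :
    (forall t, uI t -> H s t = c) -> act (pi_class h) = idm (obj c).
  move=> Hsc; apply: act_cst => u /andP[u0 u1]; apply: Hsc.
  by apply/andP; split; nra.
pose Q s :=
  exists x y (mb : hom E (obj a) (obj x)) (mt : hom E (obj a) (obj y)),
  ladder H t0 t1 s mb mt.
have [||x [y [mb [mt [bot top rung]]]]] :=
  @subdivided_ind R (in_cell Y H t0 t1) Q _ _ cells.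
- exists a, a, (idm _), (idm _); split.
  + by apply: transport_refl; case: (Hab t0 t0_uI).
  + by apply: transport_refl; case: (Hab t1 t1_uI).
  + by move=> k h; rewrite comp1m (col_cst 0) // => t /Hab [].
- move=> s0 s1 s00 s01 s11 cell [x [y [mb [mt hs0]]]].
  exact: ladder_cell hs0.
have [_ _ xb] := transport_ends bot; have [_ _ yb] := transport_ends top.
rewrite (proj2 (Hab _ _)) // in xb; rewrite (proj2 (Hab _ _)) // in yb.
subst x y.
have [k /interior_subset Yb] := cover b.
have col_b : is_dipath_from d (Y k) b b (subpath (H 1) t0 t1).
  apply: is_dipath_from_ext (const_spec d Yb) => u /andP[u0 u1].
  by case: (Hab (t0 + u * (t1 - t0))) => //; apply/andP; split; nra.
rewrite (transport_unique bot_m bot) -(compm1 mb) -(col_cst 1 b k col_b).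
  by rewrite rung.
by move=> t /Hab [].
Qed.

Lemma transport_dihomotopy a b p q (m : hom E (obj a) (obj b)) :
  dihomotopy d setT a b p q -> transport p 0 1 m -> transport q 0 1 m.
Proof.
move=> /dihomotopyP[H [dH _ Hpq Hab]] pm.
have sub := square_subdivided cover (proj1 dH).
have : transport (H^~ 1) 0 1 m; last by apply: transport_ext => u /Hpq [].
apply: (subdivided_ind (Q := fun t => transport (H^~ t) 0 1 m)) sub.
  by apply: transport_ext pm => u /Hpq [].
by move=> t0 t1 t00 t01 t11 cells; exact: transport_strip.
Qed.

Lemma transport_dhequiv a b p q (m : hom E (obj a) (obj b)) :
  dhequiv d setT a b p q -> transport p 0 1 m <-> transport q 0 1 m.
Proof.
elim=> {p q} [p q pq|p|p q _ ->|p q r _ -> _ ->] //.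
split=> [|qm]; first exact: transport_dihomotopy.
have [/transport_exists[n pn] _] := dihomotopy_from pq.
by rewrite (transport_unique qm (transport_dihomotopy pq pn)).
Qed.

Lemma act_extends :
  exists F : forall a b, pihom d setT a b -> hom E (obj a) (obj b),
  [/\ forall a (Ta : [set: X] a), F a a (pi_id d Ta) = idm (obj a),
      forall a b c f g, F a c (pi_comp f g) = comp (F a b f) (F b c g) &
      forall k a b (f : pihom d (Y k) a b), F a b (pi_widenT f) = act f].
Proof.
have val a b (f : pihom d setT a b) :
  {m : hom E (obj a) (obj b) | transport (rep f) 0 1 m} :=
    cid (transport_exists (rep_spec f)).
have valE a b p (h : is_dipath_from d setT a b p) m :
    transport p 0 1 m -> sval (val a b (pi_class h)) = m.
  move=> pm; have repm := proj2 (transport_dhequiv m (rep_pi_class h)) pm.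
  exact: transport_unique (svalP (val _ _ _)) repm.
exists (fun a b f => sval (val a b f)); split.
- move=> a Ta; apply: valE; have [k /interior_subset Ya] := cover a.
  by rewrite -(act_id Ya); exact: transport_piece.
- by move=> a b c f g; apply: valE; apply: transport_concat; exact: svalP.
- by move=> k a b f; apply: valE; rewrite -{2}[f]pi_class_rep;
    exact: transport_piece.
Qed.

End Pieces.

(** * The van Kampen theorem *)

Section VanKampenFamily.
Variables (R : realType) (X : topologicalType) (d : dspace R X).
Variables (K : Type) (Y : K -> set X).
Hypothesis cover : forall x, exists k, interior (Y k) x.
Hypothesis pieces : forall p, dipath d p -> subdivided (in_piece Y p).

Notation pY k := (pi1_full d (Y k)).
Notation pX := (pi1_full d [set: X]).

Section Existence.
Variables (E : precat) (u : forall k, functor (pY k) E).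
Hypothesis catE : is_category E.
Hypothesis fu : forall k, is_functor (u k).
Hypothesis u_agree : forall k l,
  fcomp (inclIl d (@subset_refl _ (Y k `&` Y l)) (@subset_refl _ (Y k))) (u k) =
  fcomp (inclIr d (@subset_refl _ (Y k `&` Y l)) (@subset_refl _ (Y l))) (u l).

Lemma glued_objects : exists obj : X -> ob E,
  forall k (x : ob (pY k)), fobj (u k) x = obj (proj1_sig x).
Proof.
have u_objE k l x (hk : Y k x) (hl : Y l x) :
    fobj (u k) (exist _ x hk) = fobj (u l) (exist _ x hl).
  have := congr1 (fun F : functor (pi1_full d (Y k `&` Y l)) E =>
    fobj F (exist _ x (conj hk hl))) (u_agree k l).
  by rewrite /= (Prop_irrelevance (subIsetl _) hk)
    (Prop_irrelevance (subIsetr _) hl).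
have [obj objE] :
  {obj : X -> ob E & forall x k hk, fobj (u k) (exist _ x hk) = obj x}.
  apply: (choice (P := fun x o =>
    forall k hk, fobj (u k) (exist _ x hk) = o)) => x.
  have [k /interior_subset hk] := cover x.
  by exists (fobj (u k) (exist _ x hk)) => l hl; exact: u_objE.
by exists obj => k [x hx]; exact: objE.
Qed.

Lemma functor_family_act (obj : X -> ob E) :
  (forall k (x : ob (pY k)), fobj (u k) x = obj (proj1_sig x)) ->
  exists act : forall k a b, pihom d (Y k) a b -> hom E (obj a) (obj b),
    forall k (a b : ob (pY k)) (f : hom (pY k) a b),
      arr (act k _ _ f) = arr (fmap (u k) f).
Proof.
move=> objE.
have act_ex k a b (f : pihom d (Y k) a b) :
  exists m : hom E (obj a) (obj b), arr m = arr (fmap (u k) (full_hom f)).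
  by apply: arr_retarget; exact: objE.
exists (fun k a b f => sval (cid (act_ex k a b f))) => k a b f.
by rewrite (svalP (cid (act_ex k _ _ f))); exact: arr_fmap_pi.
Qed.

Lemma van_kampen_lift : exists v : functor pX E,
  is_functor v /\ forall k, fcomp (incl_full d (Y k)) v = u k.
Proof.
have [obj objE] := glued_objects; have [act actE] := functor_family_act objE.
have act_id k a (Ya : Y k a) : act k a a (pi_id d Ya) = idm (obj a).
  have -> : pi_id d Ya = idm (exist _ a Ya : ob (pY k)) by exact: eq_sval.
  apply/arr_inj/(etrans (actE k (exist _ a Ya) (exist _ a Ya) (idm _))).
  by rewrite (proj1 (fu k)) objE.
have act_comp k a b c (f : pihom d (Y k) a b) (g : pihom d (Y k) b c) :
    act k a c (pi_comp f g) = comp (act k a b f) (act k b c g).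
  pose g' : hom (pY k) (exist _ b (pihom_cod f)) (exist _ c (pihom_cod g)) := g.
  apply/arr_inj/(etrans (actE k _ _ (comp (full_hom f) g'))).
  rewrite (proj2 (fu k)).
  exact/esym/(arr_op (@comp E) (actE k _ _ (full_hom f)) (actE k _ _ g')).
have act_agree k l a b p (hk : is_dipath_from d (Y k) a b p)
      (hl : is_dipath_from d (Y l) a b p) :
    act k a b (pi_class hk) = act l a b (pi_class hl).
  have hkl : is_dipath_from d (Y k `&` Y l) a b p.
    move: hk hl => [[dp Yk] pab] [[_ Yl] _]; split=> //; split=> // t t01.
    by split; auto.
  rewrite -(pi_widen_class (@subIsetl _ (Y k) (Y l)) hkl hk).
  rewrite -(pi_widen_class (@subIsetr _ (Y k) (Y l)) hkl hl).
  apply: arr_inj; have := arr_fmap (full_hom (pi_class hkl)) (u_agree k l).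
  by rewrite /= -!actE.
have [F [F_id F_comp F_act]] :=
  act_extends cover pieces catE act_id act_comp act_agree.
exists (@Functor pX E (fun x => obj (proj1_sig x)) (fun x y f => F _ _ f)).
split.
  by split=> [x|x y z f g]; [exact: F_id|exact: F_comp].
move=> k; apply: functor_ext => a b f; rewrite -actE; congr arr; exact: F_act.
Qed.

End Existence.

Lemma van_kampen_ext (E : precat) (v v' : functor pX E) :
  is_functor v -> is_functor v' ->
  (forall k, fcomp (incl_full d (Y k)) v = fcomp (incl_full d (Y k)) v') ->
  v = v'.
Proof.
move=> [v1 vM] [v1' vM'] vv'.
pose agree (a b : ob pX) (f : hom pX a b) := arr (fmap v f) = arr (fmap v' f).
have agree_arr a b (f : hom pX a b) a' b' (f' : hom pX a' b') :
    pi_arr f = pi_arr f' -> agree _ _ f -> agree _ _ f'.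
  by move=> ff'; rewrite /agree (arr_fmap_pi v ff') (arr_fmap_pi v' ff').
have agree_piece k a b (f : hom (pY k) a b) :
    agree _ _ (fmap (incl_full d (Y k)) f).
  exact: arr_fmap f (vv' k).
pose pt x : ob pX := exist _ x Logic.I.
pose P x y (f : pihom d setT x y) := agree (pt x) (pt y) f.
apply: functor_ext => a b f; suff : P _ _ f by exact: agree_arr.
apply: (pihom_piece_ind pieces (P := P)) => [x Tx|x y z g k h Pg].
  have [k /interior_subset Yx] := cover x.
  apply: agree_arr (agree_piece k _ _ (idm (exist _ x Yx : ob (pY k)))).
  by congr arr; exact: pi_widen_id.
have Ph : P y z (pi_widenT h).
  exact: agree_arr (agree_piece k _ _ (full_hom h)).
by have := arr_op (@comp E) Pg Ph; rewrite -vM -vM'.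
Qed.

End VanKampenFamily.

(** * Pushouts of categories *)

Section Pushouts.

Definition is_pushout (C0 C1 C2 C3 : precat) (i1 : functor C0 C1)
    (i2 : functor C0 C2) (j1 : functor C1 C3) (j2 : functor C2 C3) : Prop :=
  [/\ is_functor j1, is_functor j2, fcomp i1 j1 = fcomp i2 j2 &
    forall (E : precat) (u1 : functor C1 E) (u2 : functor C2 E),
      is_category E -> is_functor u1 -> is_functor u2 ->
      fcomp i1 u1 = fcomp i2 u2 ->
      exists! v : functor C3 E,
        [/\ is_functor v, fcomp j1 v = u1 & fcomp j2 v = u2]].

Lemma pushout_ext (C0 C1 C2 C3 : precat) (i1 : functor C0 C1)
    (i2 : functor C0 C2) (j1 : functor C1 C3) (j2 : functor C2 C3)
    (E : precat) (v v' : functor C3 E) :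
  is_pushout i1 i2 j1 j2 -> is_category E -> is_functor v -> is_functor v' ->
  fcomp j1 v = fcomp j1 v' -> fcomp j2 v = fcomp j2 v' -> v = v'.
Proof.
move=> [fj1 fj2 sq univ] catE fv fv' e1 e2.
have [|w [_ w_unique]] :=
    univ E _ _ catE (is_functor_fcomp fj1 fv) (is_functor_fcomp fj2 fv).
  exact: (congr1 (fun F => fcomp F v) sq).
by rewrite -(w_unique v) // -(w_unique v').
Qed.

Variables (C0 C1 C2 C3 D0 D1 D2 D3 : precat).
Variables (i1 : functor C0 C1) (i2 : functor C0 C2).
Variables (j1 : functor C1 C3) (j2 : functor C2 C3).
Variables (i1' : functor D0 D1) (i2' : functor D0 D2).
Variables (j1' : functor D1 D3) (j2' : functor D2 D3).
Variables (F0 : functor C0 D0) (F1 : functor C1 D1) (F2 : functor C2 D2).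
Hypotheses (fF1 : is_functor F1) (fF2 : is_functor F2).
Hypothesis iF1 : fcomp i1 F1 = fcomp F0 i1'.
Hypothesis iF2 : fcomp i2 F2 = fcomp F0 i2'.

Lemma pushout_retract (F3 : functor C3 D3)
    (s1 : functor D1 C1) (s2 : functor D2 C2) (s3 : functor D3 C3) :
  is_pushout i1 i2 j1 j2 ->
  is_functor F3 -> is_functor s3 -> is_functor j1' -> is_functor j2' ->
  fcomp i1' j1' = fcomp i2' j2' ->
  fcomp j1 F3 = fcomp F1 j1' -> fcomp j2 F3 = fcomp F2 j2' ->
  fcomp s1 j1 = fcomp j1' s3 -> fcomp s2 j2 = fcomp j2' s3 ->
  fcomp s1 F1 = fid D1 -> fcomp s2 F2 = fid D2 -> fcomp s3 F3 = fid D3 ->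
  is_pushout i1' i2' j1' j2'.
Proof.
move=> poC fF3 fs3 fj1' fj2' sq' jF1 jF2 sj1 sj2 sF1 sF2 sF3; split=> //.
move=> E w1 w2 catE fw1 fw2 sqw; have [_ _ _ univ] := poC.
have [||| v [[fv v1 v2] _]] := univ E (fcomp F1 w1) (fcomp F2 w2) catE.
- exact: is_functor_fcomp.
- exact: is_functor_fcomp.
- by rewrite -!fcompA iF1 iF2 !fcompA sqw.
exists (fcomp s3 v); split.
  split; first exact: is_functor_fcomp.
  - by rewrite -fcompA -sj1 fcompA v1 -fcompA sF1 fcomp1f.
  - by rewrite -fcompA -sj2 fcompA v2 -fcompA sF2 fcomp1f.
move=> w [fw jw1 jw2]; have -> : v = fcomp F3 w.
  apply: (pushout_ext poC catE fv (is_functor_fcomp fF3 fw)).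
  - by rewrite v1 -fcompA jF1 fcompA jw1.
  - by rewrite v2 -fcompA jF2 fcompA jw2.
by rewrite -fcompA sF3 fcomp1f.
Qed.

Lemma arrow_pushout_of_pushouts :
  is_category D3 -> is_pushout i1 i2 j1 j2 -> is_pushout i1' i2' j1' j2' ->
  exists P : functor C3 D3,
    [/\ is_functor P, fcomp j1 P = fcomp F1 j1', fcomp j2 P = fcomp F2 j2',
        (forall P' : functor C3 D3, is_functor P' ->
           fcomp j1 P' = fcomp F1 j1' -> fcomp j2 P' = fcomp F2 j2' -> P' = P) &
        arrow_pushout F0 F1 F2 P i1 i2 j1 j2 i1' i2' j1' j2'].
Proof.
move=> catD poC poD; have [fj1 fj2 sq univ] := poC.
have [fj1' fj2' sq' univ'] := poD.
have [||| P [[fP P1 P2] P_unique]] :=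
  univ D3 (fcomp F1 j1') (fcomp F2 j2') catD.
- exact: is_functor_fcomp.
- exact: is_functor_fcomp.
- by rewrite -!fcompA iF1 iF2 !fcompA sq'.
exists P; split=> //; first by move=> P' fP' P1' P2'; rewrite (P_unique P').
do 6 (split=> //).
move=> E E' G u1 u2 u1' u2' catE catE' fG fu1 fu2 fu1' fu2' uG1 uG2 squ squ'.
have [v [[fv v1 v2] v_unique]] := univ E u1 u2 catE fu1 fu2 squ.
have [v' [[fv' v1' v2'] v'_unique]] := univ' E' u1' u2' catE' fu1' fu2' squ'.
exists (v, v'); split=> /=.
  split=> //; apply: (pushout_ext poC catE'); try exact: is_functor_fcomp.
  - by rewrite -!fcompA v1 P1 uG1 fcompA v1'.
  - by rewrite -!fcompA v2 P2 uG2 fcompA v2'.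
move=> [w w'] [/= fw fw' _ [w1 w2] [w1' w2']].
by congr pair; [exact: v_unique|exact: v'_unique].
Qed.

End Pushouts.

Definition pair_family (T : Type) (A B : T) (k : bool) : T :=
  if k then A else B.

Section VanKampen.
Variables (R : realType) (X : topologicalType) (d : dspace R X) (Y1 Y2 : set X).
Hypothesis cover : [set: X] = interior Y1 `|` interior Y2.
Hypothesis pieces : forall p, dipath d p ->
  subdivided (in_piece (pair_family Y1 Y2) p).

Lemma pair_cover x : exists k, interior (pair_family Y1 Y2 k) x.
Proof.
by have : [set: X] x := Logic.I; rewrite cover => -[];
  [exists true|exists false].
Qed.

Theorem van_kampen_pushout :
  is_pushout
    (inclIl d (@subset_refl _ (Y1 `&` Y2)) (@subset_refl _ Y1))
    (inclIr d (@subset_refl _ (Y1 `&` Y2)) (@subset_refl _ Y2))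
    (incl_full d Y1) (incl_full d Y2).
Proof.
split; [exact: is_functor_incl|exact: is_functor_incl| |].
  by rewrite !incl_comp; exact: incl_irr.
move=> E u1 u2 catE fu1 fu2 sq.
pose u k : functor (pi1_full d (pair_family Y1 Y2 k)) E :=
  if k is true then u1 else u2.
have [|k l|v [fv vu]] := @van_kampen_lift _ _ _ _ _ pair_cover pieces _ u catE.
- by case.
- case: k l => [] [].
  + by congr fcomp; exact: incl_irr.
  + exact: sq.
  + have swap : Y2 `&` Y1 `<=` Y1 `&` Y2 by rewrite setIC.
    have := congr1 (fcomp (incl d (@subset_refl _ (Y2 `&` Y1))
      (@subset_refl _ (Y1 `&` Y2)) swap swap)) (esym sq).
    rewrite -!fcompA !incl_comp => sqT.
    by apply: (etrans _ (etrans sqT _)); congr fcomp; exact: incl_irr.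
  + by congr fcomp; exact: incl_irr.
exists v; split; first by split=> //; [exact: (vu true)|exact: (vu false)].
move=> w [fw w1 w2]; apply: (van_kampen_ext pair_cover pieces fv fw).
by case; rewrite vu.
Qed.

End VanKampen.

(** * Retractions *)

Section Retractions.
Variables (R : realType) (X : topologicalType) (d : dspace R X).
Implicit Types Y Z : set X.

(* The units are morphisms between points of [X], because [incl] acts as the
   identity on morphisms when the ambient set [Y] does not change. *)
Definition units Y Z Z' (hZ : Z `<=` Y) (hZ' : Z' `<=` Y)
    (Q : functor (pi1 d hZ) (pi1 d hZ')) : Type :=
  forall x : ob (pi1 d hZ), pihom d Y (proj1_sig x) (proj1_sig (fobj Q x)).

Definition is_retraction Y Z Z' (hZ : Z `<=` Y) (hZ' : Z' `<=` Y)
    (Q : functor (pi1 d hZ) (pi1 d hZ')) (th : units Q) : Prop :=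
  [/\ is_functor Q,
      forall (x y : ob (pi1 d hZ)) (f : hom (pi1 d hZ) x y),
        pi_comp f (th y) = pi_comp (th x) (fmap Q f) &
      forall x : ob (pi1 d hZ), Z' (proj1_sig x) ->
        pi_arr (th x) = pi_arr (pi_id d (hZ _ (proj2_sig x)))].

Lemma is_retraction_of_future_retract Y Z Z' (hZ : Z `<=` Y) (hZ' : Z' `<=` Y)
    (hY : Y `<=` Y) (hZ'Z : Z' `<=` Z) (Q : functor (pi1 d hZ) (pi1 d hZ'))
    (th : forall x,
      hom (pi1 d hZ) x (fobj (incl d hZ' hZ hY hZ'Z) (fobj Q x))) :
  is_future_retract (incl d hZ' hZ hY hZ'Z) Q th -> is_retraction th.
Proof.
move=> [fQ [nat_th [_ unit_th]]]; split=> // [x y f|x Z'x].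
  have -> : pi_comp f (th y) = pi_comp (th x) (pi_widen hY (fmap Q f)) :=
    nat_th x y f.
  by rewrite pi_widen_refl.
have := unit_th (exist _ (proj1_sig x) Z'x).
rewrite (_ : fobj _ _ = x); last exact: eq_sval.
by move=> /(arr_existT (H := hom (pi1 d hZ))) /arr_pi1P.
Qed.

Lemma incl_retraction Y Z Z' (hZ : Z `<=` Y) (hZ' : Z' `<=` Y) (hY : Y `<=` Y)
    (hZ'Z : Z' `<=` Z) (Q : functor (pi1 d hZ) (pi1 d hZ'))
    (th : units Q) :
  is_retraction th -> fcomp (incl d hZ' hZ hY hZ'Z) Q = fid (pi1 d hZ').
Proof.
move=> [_ nat_th unit_th]; apply: functor_ext => a b f; apply/arr_pi1P.
set i := incl _ _ _ _ _.
have := congr1 (fun g => pi_arr g) (nat_th _ _ (fmap i f)).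
have unit_a : pi_arr (th (fobj i a)) =
    pi_arr (pi_id d (pihom_cod (th (fobj i a)))).
  have unit_a := unit_th (fobj i a) (proj2_sig a).
  by rewrite unit_a; apply: pi_arr_id; exact: esym (arr_cod unit_a).
rewrite (arr_op (@pi_comp _ _ d Y) unit_a erefl) pi_comp1l => <-.
rewrite (arr_op (@pi_comp _ _ d Y) erefl (unit_th (fobj i b) (proj2_sig b)))
  pi_comp1r.
by congr arr; exact: pi_widen_refl.
Qed.

Lemma retraction_comp Y Z Z' Z'' (hZ : Z `<=` Y) (hZ' : Z' `<=` Y)
    (hZ'' : Z'' `<=` Y) (hZ''Z' : Z'' `<=` Z')
    (Q : functor (pi1 d hZ) (pi1 d hZ')) (th : units Q)
    (P : functor (pi1 d hZ') (pi1 d hZ'')) (et : units P) :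
  is_retraction th -> is_retraction et ->
  is_retraction (Q := fcomp Q P) (fun x => pi_comp (th x) (et (fobj Q x))).
Proof.
move=> [fQ nat_th unit_th] [fP nat_et unit_et]; split.
- exact: is_functor_fcomp.
- by move=> x y f;
    rewrite -pi_compA nat_th pi_compA (nat_et _ _ (fmap Q f)) pi_compA.
- move=> x Z''x; have thx := unit_th x (hZ''Z' _ Z''x); have Qx := arr_cod thx.
  have etx : pi_arr (et (fobj Q x)) = pi_arr (pi_id d (hZ _ (proj2_sig x))).
    by rewrite unit_et ?Qx //; exact: pi_arr_id.
  by rewrite (arr_op (@pi_comp _ _ d Y) thx etx) pi_comp1l.
Qed.

End Retractions.

Section GluedRetraction.
Variables (R : realType) (X : topologicalType) (d : dspace R X).
Variables (K : Type) (Y Z : K -> set X) (W : set X).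
Hypothesis cover : forall x, exists k, Y k x.
Hypothesis pieces : forall p, dipath d p -> subdivided (in_piece Y p).
Variables (hZ : forall k, Z k `<=` Y k) (hW : forall k, Z k `<=` W).
Hypothesis coverW : forall x, W x -> exists k, Z k x.

Notation pY k := (pi1_full d (Y k)).
Notation pX := (pi1_full d [set: X]).

Variable Q : forall k, functor (pY k) (pi1 d (@hZ k)).
Variable th : forall k, units (Q k).
Hypothesis Q_retraction : forall k, is_retraction (@th k).
Hypothesis th_agree : forall k l (x : ob (pY k)) (y : ob (pY l)),
  proj1_sig x = proj1_sig y ->
  pi_arr (pi_widenT (th x)) = pi_arr (pi_widenT (th y)).
Variable P : functor pX (pi1 d (@subsetT _ W)).
Hypothesis fP : is_functor P.
Hypothesis PQ : forall k, fcomp (incl_full d (Y k)) P =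
  fcomp (Q k) (incl d (@hZ k) (@subsetT _ W) (@subsetT _ _) (@hW k)).

Lemma glued_units : exists eta : units P,
  forall (x : ob pX) k (y : ob (pY k)), proj1_sig x = proj1_sig y ->
    pi_arr (eta x) = pi_arr (pi_widenT (th y)).
Proof.
suff unit_at x : exists m : pihom d setT (proj1_sig x) (proj1_sig (fobj P x)),
    forall k (y : ob (pY k)), proj1_sig x = proj1_sig y ->
      pi_arr m = pi_arr (pi_widenT (th y)).
  by exists (fun x => sval (cid (unit_at x))) => x;
    exact: svalP (cid (unit_at x)).
have [k Yx] := cover (proj1_sig x).
pose y : ob (pY k) := exist _ (proj1_sig x) Yx.
have Px : proj1_sig (fobj (Q k) y) = proj1_sig (fobj P x).
  have <- : fobj (incl_full d (Y k)) y = x by exact: eq_sval.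
  by have := congr1 (fun F : functor (pY k) (pi1 d (@subsetT _ W)) =>
    proj1_sig (fobj F y)) (PQ k).
have [m mE] := arr_retarget (pi_widenT (th y)) erefl Px.
by exists m => l z xz; rewrite mE; exact: th_agree.
Qed.

Lemma glued_retraction : exists eta : units P, is_retraction eta.
Proof.
have [eta etaE] := glued_units; exists eta; split=> // [x y f|x Wx]; last first.
  have [k Zx] := coverW Wx; have [_ _ unit_th] := Q_retraction k.
  rewrite (etaE x k (exist _ _ (hZ Zx)) erefl).
  rewrite (arr_map (@pi_widen _ _ d _ _ (@subsetT _ (Y k)))
    (unit_th (exist _ _ (hZ Zx)) Zx)).
  by congr arr; exact: pi_widen_id.
pose pt z : ob pX := exist _ z Logic.I.
pose natural a b (g : pihom d setT a b) :=
  pi_comp g (eta (pt b)) =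
    pi_comp (eta (pt a)) (fmap P (g : hom pX (pt a) (pt b))).
suff : natural _ _ f by case: x y f => [x []] [y []] f.
have [P1 PM] := fP.
apply: (pihom_piece_ind pieces (P := natural)) => [a Ta|a b c g k h nat_g].
  rewrite /natural (_ : pi_id d Ta = idm (pt a)); last exact: eq_sval.
  by rewrite P1 pi_comp1l pi_comp1r.
have [_ nat_th _] := Q_retraction k.
have Ph : pi_arr (fmap P (pi_widenT h : hom pX (pt b) (pt c))) =
    pi_arr (pi_widenT (fmap (Q k) (full_hom h))).
  have /arr_pi1P := arr_fmap (full_hom h) (PQ k).
  move=> <-; apply/arr_pi1P; exact: arr_fmap_pi.
have nat_h : natural _ _ (pi_widenT h).
  apply: arr_inj.
  rewrite (arr_op (@pi_comp _ _ d setT)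
    (etaE (pt b) k (exist _ b (pihom_dom h)) erefl) Ph).
  rewrite (arr_op (@pi_comp _ _ d setT) erefl
    (etaE (pt c) k (exist _ c (pihom_cod h)) erefl)).
  by rewrite -!pi_widen_comp -(nat_th _ _ (full_hom h)).
rewrite /natural pi_compA nat_h -pi_compA nat_g pi_compA; congr pi_comp.
exact: esym (PM _ _ _ _ _).
Qed.

End GluedRetraction.

Section CompatibleRetractions.
Variables (R : realType) (X : topologicalType) (d : dspace R X) (Y1 Y2 : set X).

Definition compatible_retractions (Z1 Z2 Z1' Z2' : set X)
    (h0 : Z1 `&` Z2 `<=` Y1 `&` Y2) (h1 : Z1 `<=` Y1) (h2 : Z2 `<=` Y2)
    (h0' : Z1' `&` Z2' `<=` Y1 `&` Y2) (h1' : Z1' `<=` Y1) (h2' : Z2' `<=` Y2)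
    (Q0 : functor (pi1 d h0) (pi1 d h0')) (Q1 : functor (pi1 d h1) (pi1 d h1'))
    (Q2 : functor (pi1 d h2) (pi1 d h2'))
    (th1 : units Q1) (th2 : units Q2) : Prop :=
  [/\ is_retraction th1, is_retraction th2,
      fcomp (inclIl d h0 h1) Q1 = fcomp Q0 (inclIl d h0' h1'),
      fcomp (inclIr d h0 h2) Q2 = fcomp Q0 (inclIr d h0' h2') &
      forall (x1 : ob (pi1 d h1)) (x2 : ob (pi1 d h2)),
        proj1_sig x1 = proj1_sig x2 ->
        pi_arr (pi_widenT (th1 x1)) = pi_arr (pi_widenT (th2 x2))].

Lemma compatible_future_retracts (Z1 Z2 Z1' Z2' : set X)
    (h0 : Z1 `&` Z2 `<=` Y1 `&` Y2) (h1 : Z1 `<=` Y1) (h2 : Z2 `<=` Y2)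
    (h0' : Z1' `&` Z2' `<=` Y1 `&` Y2) (h1' : Z1' `<=` Y1) (h2' : Z2' `<=` Y2)
    (s0 : Z1' `&` Z2' `<=` Z1 `&` Z2) (s1 : Z1' `<=` Z1) (s2 : Z2' `<=` Z2)
    (Q0 : functor (pi1 d h0) (pi1 d h0')) (Q1 : functor (pi1 d h1) (pi1 d h1'))
    (Q2 : functor (pi1 d h2) (pi1 d h2'))
    (th0 : forall x, hom (pi1 d h0) x
       (fobj (incl d h0' h0 (@subset_refl _ _) s0) (fobj Q0 x)))
    (th1 : forall x, hom (pi1 d h1) x
       (fobj (incl d h1' h1 (@subset_refl _ _) s1) (fobj Q1 x)))
    (th2 : forall x, hom (pi1 d h2) x
       (fobj (incl d h2' h2 (@subset_refl _ _) s2) (fobj Q2 x))) :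
  is_future_retract _ Q1 th1 -> is_future_retract _ Q2 th2 ->
  fcomp (inclIl d h0 h1) Q1 = fcomp Q0 (inclIl d h0' h1') ->
  fcomp (inclIr d h0 h2) Q2 = fcomp Q0 (inclIr d h0' h2') ->
  (forall x,
     existT (hom _ (fobj (inclIl d h0 h1) x)) _
       (fmap (inclIl d h0 h1) (th0 x)) =
     existT (hom _ (fobj (inclIl d h0 h1) x)) _
       (th1 (fobj (inclIl d h0 h1) x))) ->
  (forall x,
     existT (hom _ (fobj (inclIr d h0 h2) x)) _
       (fmap (inclIr d h0 h2) (th0 x)) =
     existT (hom _ (fobj (inclIr d h0 h2) x)) _
       (th2 (fobj (inclIr d h0 h2) x))) ->
  compatible_retractions Q0 th1 th2.
Proof.
move=> /is_retraction_of_future_retract r1 /is_retraction_of_future_retract r2.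
move=> c1 c2 unit1 unit2; split=> // x1 x2 x12.
have [x0 <- <-] : exists2 x0, fobj (inclIl d h0 h1) x0 = x1 &
    fobj (inclIr d h0 h2) x0 = x2.
  have Z2x : Z2 (proj1_sig x1) by rewrite x12; exact: (proj2_sig x2).
  by exists (exist _ (proj1_sig x1) (conj (proj2_sig x1) Z2x)); exact: eq_sval.
have /pi_widen_incl -> := arr_existT (H := hom (pi1 d h1)) (unit1 x0).
by have /pi_widen_incl -> := arr_existT (H := hom (pi1 d h2)) (unit2 x0).
Qed.

Lemma compatible_retractions_comp (Z1 Z2 Z1' Z2' Z1'' Z2'' : set X)
    (h0 : Z1 `&` Z2 `<=` Y1 `&` Y2) (h1 : Z1 `<=` Y1) (h2 : Z2 `<=` Y2)
    (h0' : Z1' `&` Z2' `<=` Y1 `&` Y2) (h1' : Z1' `<=` Y1) (h2' : Z2' `<=` Y2)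
    (h0'' : Z1'' `&` Z2'' `<=` Y1 `&` Y2) (h1'' : Z1'' `<=` Y1)
    (h2'' : Z2'' `<=` Y2)
    (s1 : Z1'' `<=` Z1') (s2 : Z2'' `<=` Z2')
    (Q0 : functor (pi1 d h0) (pi1 d h0')) (Q1 : functor (pi1 d h1) (pi1 d h1'))
    (Q2 : functor (pi1 d h2) (pi1 d h2'))
    (th1 : units Q1) (th2 : units Q2)
    (P0 : functor (pi1 d h0') (pi1 d h0''))
    (P1 : functor (pi1 d h1') (pi1 d h1''))
    (P2 : functor (pi1 d h2') (pi1 d h2''))
    (et1 : units P1) (et2 : units P2) :
  compatible_retractions Q0 th1 th2 -> compatible_retractions P0 et1 et2 ->
  compatible_retractions (fcomp Q0 P0) (Q1 := fcomp Q1 P1) (Q2 := fcomp Q2 P2)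
    (fun x => pi_comp (th1 x) (et1 (fobj Q1 x)))
    (fun x => pi_comp (th2 x) (et2 (fobj Q2 x))).
Proof.
move=> [r1 r2 Q01 Q02 th12] [r1' r2' P01 P02 et12]; split.
- exact: (retraction_comp s1 r1 r1').
- exact: (retraction_comp s2 r2 r2').
- by rewrite -fcompA Q01 !fcompA P01.
- by rewrite -fcompA Q02 !fcompA P02.
move=> x1 x2 x12; rewrite !pi_widen_comp.
apply: (arr_op (@pi_comp _ _ d setT)) (th12 _ _ x12) (et12 _ _ _).
exact: arr_cod (th12 _ _ x12).
Qed.

Hypothesis cover : [set: X] = interior Y1 `|` interior Y2.
Hypothesis pieces : forall p, dipath d p ->
  subdivided (in_piece (pair_family Y1 Y2) p).

Lemma glued_pair_retraction (Z1 Z2 : set X) (h0 : Z1 `&` Z2 `<=` Y1 `&` Y2)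
    (h1 : Z1 `<=` Y1) (h2 : Z2 `<=` Y2)
    (Q0 : functor (pi1_full d (Y1 `&` Y2)) (pi1 d h0))
    (Q1 : functor (pi1_full d Y1) (pi1 d h1))
    (Q2 : functor (pi1_full d Y2) (pi1 d h2))
    (th1 : units Q1) (th2 : units Q2)
    (P : functor (pi1_full d setT) (pi1 d (@subsetT _ (Z1 `|` Z2)))) :
  compatible_retractions Q0 th1 th2 -> is_functor P ->
  fcomp (incl_full d Y1) P = fcomp Q1 (inclUl d h1 Z2) ->
  fcomp (incl_full d Y2) P = fcomp Q2 (inclUr d h2 Z1) ->
  exists eta : units P, is_retraction eta.
Proof.
move=> [r1 r2 Q01 Q02 th12] fP JP1 JP2.
pose Y := pair_family Y1 Y2; pose Z := pair_family Z1 Z2.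
pose hZ k : Z k `<=` Y k := if k is true then h1 else h2.
pose hU k : Z k `<=` Z1 `|` Z2 :=
  if k is true then @subsetUl _ _ _ else @subsetUr _ _ _.
pose Q k : functor (pi1_full d (Y k)) (pi1 d (hZ k)) :=
  if k is true then Q1 else Q2.
pose th k : units (Q k) := if k is true then th1 else th2.
have coverY x : exists k, Y k x.
  by have [k /interior_subset Yx] := pair_cover cover x; exists k.
have coverZ x : (Z1 `|` Z2) x -> exists k, Z k x.
  by move=> [Zx|Zx]; [exists true|exists false].
apply: (@glued_retraction _ _ d bool Y Z _ coverY pieces hZ hU coverZ Q th).
- by case.
- move=> [] [] x y xy; [|exact: th12|exact/esym/th12/esym|].
  + by have -> : x = y by exact: eq_sval.
  + by have -> : x = y by exact: eq_sval.
- exact: fP.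
- by case; [exact: JP1|exact: JP2].
Qed.

Theorem retract_van_kampen (Z1 Z2 : set X) (h0 : Z1 `&` Z2 `<=` Y1 `&` Y2)
    (h1 : Z1 `<=` Y1) (h2 : Z2 `<=` Y2)
    (Q0 : functor (pi1_full d (Y1 `&` Y2)) (pi1 d h0))
    (Q1 : functor (pi1_full d Y1) (pi1 d h1))
    (Q2 : functor (pi1_full d Y2) (pi1 d h2))
    (th1 : units Q1) (th2 : units Q2) :
  compatible_retractions Q0 th1 th2 ->
  is_pushout (inclIl d h0 h1) (inclIr d h0 h2)
    (inclUl d h1 Z2) (inclUr d h2 Z1).
Proof.
move=> Qth; have [r1 r2 Q01 Q02 _] := Qth.
have [fQ1 _ _] := r1; have [fQ2 _ _] := r2.
have vk := van_kampen_pushout cover pieces; have [_ _ _ univ] := vk.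
have fj1 : is_functor (inclUl d h1 Z2) by exact: is_functor_incl.
have fj2 : is_functor (inclUr d h2 Z1) by exact: is_functor_incl.
have sqZ : fcomp (inclIl d h0 h1) (inclUl d h1 Z2) =
    fcomp (inclIr d h0 h2) (inclUr d h2 Z1).
  by rewrite !incl_comp; exact: incl_irr.
have [||| P [[fP JP1 JP2] _]] :=
  univ _ (fcomp Q1 (inclUl d h1 Z2)) (fcomp Q2 (inclUr d h2 Z1))
    (pi1_category _ _).
- exact: is_functor_fcomp.
- exact: is_functor_fcomp.
- by rewrite -!fcompA Q01 Q02 !fcompA sqZ.
have [eta P_retraction] := glued_pair_retraction Qth fP JP1 JP2.
apply: (pushout_retract fQ1 fQ2 Q01 Q02 vk fP _ fj1 fj2 sqZ JP1 JP2
  (s1 := incl d h1 (@subset_refl _ Y1) (@subset_refl _ _) h1)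
  (s2 := incl d h2 (@subset_refl _ Y2) (@subset_refl _ _) h2)
  (s3 := incl d (@subsetT _ _) (@subset_refl _ setT) (@subset_refl _ _)
  (@subsetT _ _))).
- exact: is_functor_incl.
- by rewrite !incl_comp; exact: incl_irr.
- by rewrite !incl_comp; exact: incl_irr.
- exact: incl_retraction r1.
- exact: incl_retraction r2.
- exact: incl_retraction P_retraction.
Qed.

End CompatibleRetractions.

Lemma vk_hyps_pieces (R : realType) (X : topologicalType) (d : dspace R X)
    (V : vk_data X) (p : R -> X) : vk_hyps d V -> dipath d p ->
  subdivided (in_piece (pair_family (X1 V) (X2 V)) p).
Proof.
move=> [_ [cut _]] /cut[n [t [t0 [tn [t_lt pieces]]]]].
apply: (subdivided_seq t0 tn) => i ltin; first exact/ltW/t_lt.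
by case: (pieces i ltin) => Yp; [exists true|exists false].
Qed.

Theorem theorem4p6 (R : realType) (X : topologicalType) (d : dspace R X)
  (V : vk_data X)
  (Q0 : functor (cX0 d V) (cB0 d V)) (Q1 : functor (cX1 d V) (cB1 d V))
  (Q2 : functor (cX2 d V) (cB2 d V))
  (th0 : forall x, hom (cX0 d V) x (fobj (kB0 d V) (fobj Q0 x)))
  (th1 : forall x, hom (cX1 d V) x (fobj (kB1 d V) (fobj Q1 x)))
  (th2 : forall x, hom (cX2 d V) x (fobj (kB2 d V) (fobj Q2 x)))
  (P0 : functor (cB0 d V) (cA0 d V)) (P1 : functor (cB1 d V) (cA1 d V))
  (P2 : functor (cB2 d V) (cA2 d V))
  (et0 : forall x, hom (cB0 d V) x (fobj (kA0 d V) (fobj P0 x)))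
  (et1 : forall x, hom (cB1 d V) x (fobj (kA1 d V) (fobj P1 x)))
  (et2 : forall x, hom (cB2 d V) x (fobj (kA2 d V) (fobj P2 x))) :
  vk_hyps d V ->
  compatible_Q th0 th1 th2 ->
  compatible_P et0 et1 et2 ->
  exists P : functor (cBX d V) (cAX d V),
    [/\ is_functor P,
        fcomp (j1 d V) P = fcomp P1 (j1' d V),
        fcomp (j2 d V) P = fcomp P2 (j2' d V),
        (forall P' : functor (cBX d V) (cAX d V), is_functor P' ->
           fcomp (j1 d V) P' = fcomp P1 (j1' d V) ->
           fcomp (j2 d V) P' = fcomp P2 (j2' d V) -> P' = P) &
        arrow_pushout P0 P1 P2 P (i1 d V) (i2 d V) (j1 d V) (j2 d V)
          (i1' d V) (i2' d V) (j1' d V) (j2' d V)].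
Proof.
move=> vk [_ [rQ1 [rQ2 [cQ1 [cQ2 [uQ1 uQ2]]]]]]
  [_ [rP1 [rP2 [cP1 [cP2 [uP1 uP2]]]]]].
have Q_compatible := compatible_future_retracts rQ1 rQ2 cQ1 cQ2 uQ1 uQ2.
have P_compatible := compatible_future_retracts rP1 rP2 cP1 cP2 uP1 uP2.
have cover := proj1 vk; have pieces p := @vk_hyps_pieces R X d V p vk.
have pushoutB : is_pushout (i1 d V) (i2 d V) (j1 d V) (j2 d V).
  exact: (retract_van_kampen cover pieces Q_compatible).
have pushoutA : is_pushout (i1' d V) (i2' d V) (j1' d V) (j2' d V).
  apply: (retract_van_kampen cover pieces).
  exact: (compatible_retractions_comp (@hA1B1 _ V) (@hA2B2 _ V)
    Q_compatible P_compatible).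
have [fP1 _] := rP1; have [fP2 _] := rP2.
exact: (arrow_pushout_of_pushouts fP1 fP2 cP1 cP2 (pi1_category _ _)
  pushoutB pushoutA).
Qed.
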